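(* Let $(\omega_0,g_0)$ be a hermitian structure on a nonabelian real Lie algebra $(\mathfrak g,[\cdot,\cdot])$ of dimension $2n$, and let $\mu(t)$, $t\in(T_-,T_+)$, be the maximal solution of the Chern-Ricci bracket flow $\frac{d}{dt}\mu=\delta_\mu(P_\mu)$, $\mu(0)=[\cdot,\cdot]$. Then the normalized solution $\mu(t)/|\mu(t)|$ converges, as $t\to T_+$ (resp. as $t\to T_-$), to a nonabelian (i.e. nonzero) Lie bracket $\lambda_+$ (resp. $\lambda_-$) on the vector space $\mathfrak g$ such that $(G_{\lambda_\pm},\omega_0,g_0)$ is a Chern-Ricci soliton.
   Context: A hermitian structure on a real Lie algebra $(\mathfrak g,\mu)$ of dimension $2n$ is a pair $(\omega,g)$ with $\omega$ a non-degenerate $2$-form and $g$ an inner product such that $J$ defined by $\omega=g(J\cdot,\cdot)$ satisfies $J^2=-I$ and $\mu(JX,JY)-\mu(X,Y)-J\mu(JX,Y)-J\mu(X,JY)=0$ for all $X,Y$. Its Chern-Ricci form is $$p(X,Y)=-\tfrac12\mathrm{tr}(J\,\mathrm{ad}_\mu\mu(X,Y))+\tfrac12\mathrm{tr}(\mathrm{ad}_\mu(J\mu(X,Y))),$$ a $(1,1)$-form, and its Chern-Ricci operator $P$ is defined by $p=\omega(P\cdot,\cdot)$. $P_\mu$ denotes the Chern-Ricci operator of $(\omega_0,g_0)$ on the Lie algebra $(\mathfrak g,\mu)$, $G_\mu$ the simply connected Lie group with Lie algebra $(\mathfrak g,\mu)$ (endowed with the left-invariant structure defined by $(\omega_0,g_0)$),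 and $\delta_\mu(A):=\mu(A\cdot,\cdot)+\mu(\cdot,A\cdot)-A\mu(\cdot,\cdot)$ for $A\in\mathrm{End}(\mathfrak g)$. $|\mu|^2=\sum_{i,j}g_0(\mu(e_i,e_j),\mu(e_i,e_j))$ for any $g_0$-orthonormal basis $\{e_i\}$. Definition. A left-invariant hermitian structure $(\omega,g)$ on a Lie group with Lie algebra $\mathfrak g$ is a Chern-Ricci soliton if $P=cI+\frac12(D+D^t)$ for some $c\in\mathbb R$ and some derivation $D$ of $\mathfrak g$ with $DJ=JD$ (transpose relative to $g$). *)

(* Defs.v *)
From HB Require Import structures.
From mathcomp Require Import all_boot all_order all_algebra.
From mathcomp Require Import ring.
From mathcomp Require Import all_classical all_reals all_analysis.

Set Implicit Arguments.
Unset Strict Implicit.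
Unset Printing Implicit Defensive.

Import Order.TTheory GRing.Theory Num.Theory.
Import numFieldNormedType.Exports.

Local Open Scope classical_set_scope.
Local Open Scope ring_scope.

(* Bilinear maps V x V -> V, curried: [mu X] is the endomorphism ad_mu X. *)
Notation bracket V := 'Hom(V, 'Hom(V, V)).

Section Algebra.
Context {R : realType} {V : vectType R}.
Implicit Types (g : {dot V for idfun}) (w : {skew_symmetric V}).
Implicit Types (mu lam nu : bracket V) (A D J P : 'End(V)).

Definition is_skew_bracket mu := forall X, mu X X = 0.

Definition is_lie_bracket mu :=
  is_skew_bracket mu /\
  forall X Y Z, mu X (mu Y Z) + mu Y (mu Z X) + mu Z (mu X Y) = 0.

Definition is_derivation mu D :=
  forall X Y, D (mu X Y) = mu (D X) Y + mu X (D Y).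

Definition lfun_tr A : R :=
  \tr (passmx.mxof (vbasis {:V}) (vbasis {:V}) A).

(* The operator A determined by a(X, Y) = b(A X, Y), for b nondegenerate;
   see form_opP and form_op_unique. *)
Definition form_op (b a : V -> V -> R) : 'End(V) :=
  @xget 'End(V) 0 [set A | forall X Y, a X Y = b (A X) Y].

Definition adjoint g D : 'End(V) := form_op g (fun X Y => g X (D Y)).

Definition complex_structure w g : 'End(V) := form_op g w.

(* The definition of a nondegenerate 2-form w and of an inner product g being
   carried by the types of w and g except for nondegeneracy of w. *)
Definition is_hermitian mu w g :=
  let J := complex_structure w g in
  [/\ nondegenerate w,
      (J \o J)%VF = - \1%VF
    & forall X Y, mu (J X) (J Y) - mu X Y - J (mu (J X) Y) - J (mu X (J Y)) = 0].

Definition chern_ricci_form mu w g (X Y : V) : R :=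
  let J := complex_structure w g in
  - 2^-1 * lfun_tr (J \o mu (mu X Y))%VF + 2^-1 * lfun_tr (mu (J (mu X Y))).

Definition chern_ricci_op mu w g : 'End(V) :=
  form_op w (chern_ricci_form mu w g).

Definition is_chern_ricci_soliton mu w g :=
  let J := complex_structure w g in
  is_hermitian mu w g /\
  exists (c : R) (D : 'End(V)),
    [/\ is_derivation mu D,
        (D \o J)%VF = (J \o D)%VF
      & chern_ricci_op mu w g = c *: \1%VF + 2^-1 *: (D + adjoint g D)].

(* Evaluated form: see deltaE. *)
Definition delta mu A : bracket V :=
  linfun (fun X => mu (A X) + (mu X \o A)%VF - (A \o mu X)%VF).

(* A g-orthonormal basis; the choice does not affect bracket_norm, see
   bracket_normE. *)
Definition onb g : (\dim {:V}).-tuple V :=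
  @xget ((\dim {:V}).-tuple V) (vbasis {:V}) [set e | orthonormal g e].

Definition bracket_norm g mu : R :=
  Num.sqrt (\sum_(i < \dim {:V}) \sum_(j < \dim {:V})
    g (mu (tnth (onb g) i) (tnth (onb g) j))
      (mu (tnth (onb g) i) (tnth (onb g) j))).

Definition bracket_cvg g (T : Type) (F : set_system T) (f : T -> bracket V) lam :=
  (fun t => bracket_norm g (f t - lam)) @ F --> (0 : R).

Definition bracket_is_derive g (f : R -> bracket V) (t : R) nu :=
  bracket_cvg g (0 : R)^' (fun h : R => h^-1 *: (f (t + h) - f t)) nu.

(* The flow lives on the space of skew-symmetric bilinear maps; a and b may be
   infinite. *)
Definition is_bracket_flow w g (a b : \bar R) (mu : R -> bracket V) :=
  forall t : R, (a < t%:E < b)%E ->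
    is_skew_bracket (mu t) /\
    bracket_is_derive g mu t (delta (mu t) (chern_ricci_op (mu t) w g)).

(* Values of [mu] outside ]a, b[ are irrelevant. *)
Definition is_maximal_bracket_flow w g mu0 (a b : \bar R)
    (mu : R -> bracket V) :=
  [/\ (a < 0 < b)%E, mu 0 = mu0, is_bracket_flow w g a b mu
    & forall (a' b' : \bar R) (nu : R -> bracket V),
        (a' <= a)%E -> (b <= b')%E -> is_bracket_flow w g a' b' nu ->
        (forall t : R, (a < t%:E < b)%E -> nu t = mu t) ->
        a' = a /\ b' = b].

Definition normalized_bracket g mu : bracket V := (bracket_norm g mu)^-1 *: mu.

End Algebra.

Section Endpoint.
Context {R : realType}.

(* t --> b from below; only used with b != -oo. *)
Definition to_right_end (b : \bar R) : set_system R :=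
  match b with
  | r%:E => r^'-
  | +oo%E => pinfty_nbhs R
  | -oo%E => ninfty_nbhs R
  end.

(* t --> a from above; only used with a != +oo. *)
Definition to_left_end (a : \bar R) : set_system R :=
  match a with
  | r%:E => r^'+
  | +oo%E => pinfty_nbhs R
  | -oo%E => ninfty_nbhs R
  end.

End Endpoint.

Section Facts.
Context {R : realType} {V : vectType R}.
Implicit Types (g : {dot V for idfun}) (w : {skew_symmetric V}).
Implicit Types (mu : bracket V) (A : 'End(V)).

Lemma deltaE mu A X Y :
  delta mu A X Y = mu (A X) Y + mu X (A Y) - A (mu X Y).
Proof.
pose f X : 'End(V) := (mu (A X) + (mu X \o A) - (A \o mu X))%VF.
have lin : linear f.
  move=> c x y; apply/lfunP => z; rewrite /f.
  rewrite !(add_lfunE, opp_lfunE, scale_lfunE, comp_lfunE, linearP) /=.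
  by rewrite !scalerDr [X in X + _ = _]addrACA [LHS]addrACA.
pose lf := GRing.isLinear.Build _ _ _ _ f lin.
pose F : {linear V -> 'End(V)} := HB.pack f lf.
rewrite /delta -[X in linfun X]/(F : _ -> _) lfunE /=.
by rewrite !(add_lfunE, opp_lfunE, comp_lfunE).
Qed.

Lemma form_op_unique (b : V -> V -> R) (A B : 'End(V)) :
  bilinear_for *%R *%R b -> (forall X, (forall Y, b X Y = 0) -> X = 0) ->
  (forall X Y, b (A X) Y = b (B X) Y) -> A = B.
Proof.
move=> [bl _] nd AB; apply/lfunP => X; apply/eqP; rewrite -subr_eq0; apply/eqP.
by apply: nd => Y; rewrite addrC -scaleN1r bl AB /= mulN1r addNr.
Qed.

Lemma form_opP (b a : V -> V -> R) :
  bilinear_for *%R *%R b -> bilinear_for *%R *%R a ->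
  (forall X, (forall Y, b X Y = 0) -> X = 0) ->
  forall X Y, a X Y = b (form_op b a X) Y.
Proof.
move=> [bl br] [al ar] nd.
pose e := vbasis {:V}; pose n := \dim {:V}.
pose co (c : V -> V -> R) X : 'rV[R]_n := \row_j c X e`_j.
have coL c : (forall Y, GRing.linear_for *%R (c^~ Y)) -> linear (co c).
  by move=> cl k x y; apply/rowP => j; rewrite !mxE cl.
have coE c X Y : GRing.linear_for *%R (c X) ->
    c X Y = \sum_j coord e j Y * co c X 0 j.
  move=> cr.
  have c0 : c X 0 = 0.
    by have := cr (-1) 0 0; rewrite scaler0 addr0 mulN1r addrC subrr.
  have cD x y : c X (x + y) = c X x + c X y.
    by have := cr 1 x y; rewrite scale1r mul1r.
  have cZ k x : c X (k *: x) = k * c X x.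
    by have := cr k x 0; rewrite !addr0 c0 addr0.
  rewrite {1}(coord_vbasis (memvf Y)) (big_morph _ cD c0).
  by apply: eq_bigr => j _; rewrite cZ mxE.
pose lb := GRing.isLinear.Build _ _ _ _ (co b) (coL _ bl).
pose la := GRing.isLinear.Build _ _ _ _ (co a) (coL _ al).
pose fb : {linear V -> 'rV[R]_n} := HB.pack (co b) lb.
pose fa : {linear V -> 'rV[R]_n} := HB.pack (co a) la.
pose B := linfun fb; pose C := linfun fa.
have kB : lker B = 0%VS.
  apply/eqP; rewrite -subv0; apply/subvP => X.
  rewrite memv_ker memv0 lfunE => /eqP /= BX; apply/eqP/nd => Y.
  by rewrite (coE b) ?BX //= big1 // => j _; rewrite mxE mulr0.
have limB : limg B = fullv.
  apply/eqP; rewrite eqEdim subvf /= limg_dim_eq ?kB ?capv0 //.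
  by rewrite [leqRHS]dimvf -/(dim V) -dimvf dimvf dim_matrix mul1r.
pose A := (B^-1 \o C)%VF.
apply: (@xgetPex 'End(V) 0 [set A | forall X Y, a X Y = b (A X) Y]).
exists A => X Y; rewrite (coE a) // (coE b) //.
have -> : co b (A X) = co a X; last by [].
have : B (A X) = C X by rewrite comp_lfunE limg_lfunVK // limB memvf.
by rewrite !lfunE.
Qed.

Lemma dot_ndeg g X : (forall Y, g X Y = 0) -> X = 0.
Proof.
move=> gX; apply/eqP; apply: contraT => /(neq0_dnorm_gt0 (s := g)).
by rewrite gX ltxx.
Qed.

Lemma skew_ndeg w X : nondegenerate w -> (forall Y, w X Y = 0) -> X = 0.
Proof.
move=> /eqP ndw wX; apply/eqP; rewrite -memv0 -ndw.
by apply/mem_orthovP => Y _; exact: wX.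
Qed.

Lemma complex_structureP w g X Y : w X Y = g (complex_structure w g X) Y.
Proof.
apply: form_opP; last exact: dot_ndeg.
- by split=> z k x y; rewrite ?(linearPl, linearPr).
- by split=> z k x y; rewrite ?(linearPl, linearPr).
Qed.

Lemma adjointP g (D : 'End(V)) X Y : g X (D Y) = g (adjoint g D X) Y.
Proof.
apply: (form_opP (a := fun X Y => g X (D Y))); last exact: dot_ndeg.
- by split=> z k x y; rewrite ?(linearPl, linearPr).
- by split=> z k x y /=; rewrite ?linearP ?(linearPl, linearPr).
Qed.

Lemma lfun_tr_linear : linear (@lfun_tr R V : 'End(V) -> R^o).
Proof. by move=> c A B; rewrite /lfun_tr passmx.mxof_linear linearP. Qed.

Lemma chern_ricci_form_bilinear mu w g :
  bilinear_for *%R *%R (chern_ricci_form mu w g).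
Proof.
have pE (u v Z : V) c :
    let J := complex_structure w g in
    let q Z := - 2^-1 * lfun_tr (J \o mu Z)%VF + 2^-1 * lfun_tr (mu (J Z)) in
    q (c *: u + v) = c * q u + q v.
  move=> J q; rewrite /q !linearP.
  have -> : (J \o (c *: mu u + mu v) = c *: (J \o mu u) + (J \o mu v))%VF.
    by apply/lfunP => z; rewrite !(add_lfunE, scale_lfunE, comp_lfunE, linearP).
  rewrite !lfun_tr_linear /GRing.scale /=.
  by ring.
split=> z c x y; rewrite /chern_ricci_form -pE //.
  by rewrite linearP add_lfunE scale_lfunE.
by rewrite linearP.
Qed.

Lemma chern_ricci_opP mu w g X Y : nondegenerate w ->
  chern_ricci_form mu w g X Y = w (chern_ricci_op mu w g X) Y.
Proof.
move=> ndw; apply: form_opP; last by move=> ?; exact: skew_ndeg.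
- by split=> z k x y; rewrite ?(linearPl, linearPr).
- exact: chern_ricci_form_bilinear.
Qed.

Lemma dotC g X Y : g X Y = g Y X.
Proof. by rewrite hermC /= expr0 mul1r. Qed.

Lemma orthonormalE_nth g (s : seq V) : orthonormal g s <->
  forall i j, (i < size s)%N -> (j < size s)%N -> g s`_i s`_j = (i == j)%:R.
Proof.
rewrite /orthonormal; elim: s => [|v s IH] /=; first by split.
rewrite andbT; split.
- move=> /andP[/andP[/eqP v1 s1] /andP[/allP vs ss]].
  have {}IH := IH.1 (introT andP (conj s1 ss)).
  have vsE k : (k < size s)%N -> g v s`_k = 0.
    by move=> ks; apply/eqP/vs/mem_nth.
  move=> [|i] [|j] //=; rewrite ?ltnS => hi hj.
  + by rewrite vsE.
  + by rewrite dotC vsE.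
  + by rewrite IH.
- move=> H; have /andP[s1 ss] : all [pred v | g v v == 1] s && pair_ortho_rec g s.
    by apply/IH => i j hi hj; have := H i.+1 j.+1 hi hj.
  rewrite s1 ss (H 0%N 0%N) //= eqxx !andbT /=.
  apply/allP => x /(nthP 0)[i hi <-] /=.
  by rewrite (H 0%N i.+1).
Qed.

Lemma orthonormal_tnth g m (e : m.-tuple V) : orthonormal g e <->
  forall i j, g (tnth e i) (tnth e j) = (i == j)%:R.
Proof.
rewrite orthonormalE_nth size_tuple; split.
  by move=> H i j; rewrite !(tnth_nth 0) H.
move=> H i j hi hj; have := H (Ordinal hi) (Ordinal hj).
by rewrite !(tnth_nth 0).
Qed.

Lemma orthonormal_extend g (s : seq V) : orthonormal g s ->
  (size s < \dim {:V})%N -> exists v, orthonormal g (v :: s).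
Proof.
move=> os sn.
have /subvPn [v _ vs] : ~~ ({:V} <= span s)%VS.
  apply/negP => /dimvS; apply/negP; rewrite -ltnNge.
  exact: leq_ltn_trans (dim_span s) sn.
pose u := v - \sum_(i < size s) g v s`_i *: s`_i.
have u0 : u != 0.
  apply: contra vs; rewrite subr_eq0 => /eqP ->.
  by apply: rpred_sum => i _; apply/rpredZ/memv_span/mem_nth.
have us i : (i < size s)%N -> g u s`_i = 0.
  move=> hi; rewrite /u linearBl /= linear_sumlz (bigD1 (Ordinal hi)) //= big1.
    have ii := (orthonormalE_nth g s).1 os i i hi hi.
    by rewrite linearZl_LR /= ii eqxx mulr1 addr0 subrr.
  move=> j; rewrite -val_eqE /= => /negbTE ji.
  by rewrite linearZl_LR /= ((orthonormalE_nth g s).1 os) // ji mulr0.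
have gu : 0 < g u u by exact: neq0_dnorm_gt0.
exists ((Num.sqrt (g u u))^-1 *: u).
move: os => /andP[s1 ss]; rewrite /orthonormal /= s1 ss !andbT; apply/andP; split.
  rewrite linearZl_LR linearZr_LR /= mulrA -invfM -expr2 sqr_sqrtr ?ltW //.
  by rewrite mulVf // gt_eqF.
apply/allP => x /(nthP 0)[i hi <-] /=.
by rewrite linearZl_LR /= us // mulr0.
Qed.

Lemma orthonormal_exists g : exists e : (\dim {:V}).-tuple V, orthonormal g e.
Proof.
suff [s [ss os]] : exists s : seq V, size s = \dim {:V} /\ orthonormal g s.
  by exists (Tuple (introT eqP ss)).
have : (\dim {:V} <= \dim {:V})%N by [].
elim: {1 3}(\dim {:V}) => [|k IH] hk; first by exists [::].
have [s [sk os]] := IH (ltnW hk).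
have [|v vo] := orthonormal_extend os; first by rewrite sk.
by exists (v :: s); rewrite /= sk.
Qed.

Lemma onbP g : orthonormal g (onb g).
Proof.
apply: (@xgetPex ((\dim {:V}).-tuple V) _ [set e | orthonormal g e]).
exact: orthonormal_exists.
Qed.

Lemma orthonormal_expand g (e : (\dim {:V}).-tuple V) X : orthonormal g e ->
  X = \sum_i g X (tnth e i) *: tnth e i.
Proof.
move=> /orthonormal_tnth oe.
have gs (c : 'I_(\dim {:V}) -> R) j : g (\sum_i c i *: tnth e i) (tnth e j) = c j.
  rewrite linear_sumlz (bigD1 j) //= big1 => [|i /negbTE ij].
    by rewrite linearZl_LR /= oe eqxx mulr1 addr0.
  by rewrite linearZl_LR /= oe ij mulr0.
have fe : free e.
  apply/freeP => k k0 i.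
  rewrite -(gs k i) (_ : \sum_i _ = 0) ?linear0l //.
  by rewrite -[RHS]k0; apply: eq_bigr => j _; rewrite (tnth_nth 0).
have be : basis_of {:V} e by rewrite basisEfree fe subvf size_tuple leqnn.
have XE := coord_basis be (memvf X).
have XE' : X = \sum_i coord e i X *: tnth e i.
  by rewrite {1}XE; apply: eq_bigr => j _; rewrite (tnth_nth 0).
by rewrite {1}XE'; apply: eq_bigr => i _; rewrite {2}XE' gs.
Qed.

Lemma orthonormal_sum g (B : V -> V -> R) (e f : (\dim {:V}).-tuple V) :
  bilinear_for *%R *%R B -> orthonormal g e -> orthonormal g f ->
  \sum_i B (tnth f i) (tnth f i) = \sum_i B (tnth e i) (tnth e i).
Proof.
move=> [Bl Br] oe of_.
have Bls Y (c : 'I_(\dim {:V}) -> R) (h : 'I_(\dim {:V}) -> V) :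
    B (\sum_i c i *: h i) Y = \sum_i c i * B (h i) Y.
  pose lb := GRing.isLinear.Build _ _ R^o _ (B^~ Y) (Bl Y).
  pose b : {linear V -> R^o} := HB.pack (B^~ Y) lb.
  rewrite -[LHS]/(b _) linear_sum; apply: eq_bigr => i _.
  by rewrite linearZ.
have Brs X (c : 'I_(\dim {:V}) -> R) (h : 'I_(\dim {:V}) -> V) :
    B X (\sum_i c i *: h i) = \sum_i c i * B X (h i).
  pose lb := GRing.isLinear.Build _ _ R^o _ (B X) (Br X).
  pose b : {linear V -> R^o} := HB.pack (B X) lb.
  rewrite -[LHS]/(b _) linear_sum; apply: eq_bigr => i _.
  by rewrite linearZ.
transitivity (\sum_i \sum_k g (tnth f i) (tnth e k) * B (tnth e k) (tnth f i)).
  apply: eq_bigr => i _; rewrite -Bls.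
  by rewrite -(orthonormal_expand (tnth f i) oe).
rewrite exchange_big /=; apply: eq_bigr => k _.
rewrite [X in _ = B _ X](orthonormal_expand (tnth e k) of_) Brs.
by apply: eq_bigr => i _; rewrite dotC.
Qed.

Lemma bracket_normE g mu (e : (\dim {:V}).-tuple V) : orthonormal g e ->
  bracket_norm g mu = Num.sqrt (\sum_(i < \dim {:V}) \sum_(j < \dim {:V})
    g (mu (tnth e i) (tnth e j)) (mu (tnth e i) (tnth e j))).
Proof.
move=> oe; congr Num.sqrt; have of_ := onbP g.
transitivity (\sum_(i < \dim {:V}) \sum_(j < \dim {:V})
    g (mu (tnth (onb g) i) (tnth e j)) (mu (tnth (onb g) i) (tnth e j))).
  apply: eq_bigr => i _; set m := mu _.
  apply: (orthonormal_sum (B := fun X Y => g (m X) (m Y))) oe of_.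
  by split=> z k x y /=; rewrite linearP ?(linearPl, linearPr).
rewrite exchange_big [RHS]exchange_big /=; apply: eq_bigr => j _.
apply: (orthonormal_sum (B := fun X Y => g (mu X (tnth e j)) (mu Y (tnth e j))))
  oe of_.
by split=> z k x y /=; rewrite linearP add_lfunE scale_lfunE ?(linearPl, linearPr).
Qed.

End Facts.

(* Main.v *)
(* The Chern-Ricci operator P of mu0 is symmetric and commutes with J, because
   the Chern-Ricci form is of type (1,1). In an orthonormal eigenbasis
   P e_i = p_i e_i, the bracket flow is solved explicitly by
   mu(t) = h mu0(h^-1 ., h^-1 .) with h = (1 - 2 t P)^(1/2), on the interval where
   all 1 - 2 t p_i are positive; along it the Chern-Ricci operator is diagonal with
   entries p_i / (1 - 2 t p_i). Since the flow is polynomial, it has no other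
   solution, and its maximal interval is this one. At an end of the interval each
   1 - 2 t p_i is, up to a common factor and a factor converging to a positive
   number, either 1 or a quantity s tending to 0. Hence each structure constant of
   mu(t) is asymptotic to a multiple of a power of s, and those with the lowest
   power survive in the normalized limit lam. The exponents of s define a derivation
   of lam, and the Chern-Ricci operator of lam is an affine function of them. *)
Require Import Defs.
From HB Require Import structures.
From mathcomp Require Import all_boot all_order all_algebra.
From mathcomp Require Import ring lra.
From mathcomp Require Import complex.
From mathcomp Require Import all_classical all_reals all_analysis.
Set Implicit Arguments.
Unset Strict Implicit.
Unset Printing Implicit Defensive.
Import Order.TTheory GRing.Theory Num.Theory.
Import numFieldNormedType.Exports.
Local Open Scope classical_set_scope.
Local Open Scope ring_scope.

(** The square root in h comes from an ansatz. For mu = h mu0(h^-1 ., h^-1 .) with h diagonal and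
    commuting with J, the traces in the Chern-Ricci form are invariant under conjugation, so the
    Chern-Ricci operator becomes h^-1 P h^-1. The flow then reduces to h' = - h^-1 P, that is (h^2)'
    = - 2 P. The norm of mu(t) is awkward to follow directly. The limit is therefore found for an
    explicit positive rescaling and normalized afterwards, and the Chern-Ricci operator of the limit
    is read off from ratios of eigenvalues, in which the scale cancels. The Jacobi identity,
    integrability and the entries of the Chern-Ricci operator are polynomial in the bracket, so they
    pass to the limit. *)

(** * Real eigenvectors of symmetric matrices *)

Lemma symmetric_eigenvector (R : rcfType) (m : nat) (A : 'M[R]_m) :
  (0 < m)%N -> A^T = A -> exists a (v : 'rV[R]_m), v != 0 /\ v *m A = a *: v.
Proof.
move=> m0 symA; pose C : numClosedFieldType := complex.complex R.
pose f (x : R) : C := complex.Complex x 0.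
(* An eigenvector is taken over the algebraic closure; one of its real and imaginary parts x, y will
   serve as a real eigenvector. *)
have [a /eigenvalueP[v vA v0]] := eigenvalue_closed (\matrix_(i, j) f (A i j)) m0.
pose x : 'rV[R]_m := \row_j complex.Re (v 0 j).
pose y : 'rV[R]_m := \row_j complex.Im (v 0 j).
have sumE (T : seq 'I_m) (F : 'I_m -> C) :
    (complex.Re (\sum_(i <- T) F i) = \sum_(i <- T) complex.Re (F i)) *
    (complex.Im (\sum_(i <- T) F i) = \sum_(i <- T) complex.Im (F i)).
  by split; elim: T => [|i T IH]; rewrite ?big_nil // !big_cons -IH;
    case: (F i) (\sum_(_ <- _) _) => [? ?] [].
have mulE (z t : C) :
    (complex.Re (z * t) = complex.Re z * complex.Re t - complex.Im z * complex.Im t) *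
    (complex.Im (z * t) = complex.Re z * complex.Im t + complex.Im z * complex.Re t).
  by case: z t => [? ?] [].
have xA : x *m A = complex.Re a *: x - complex.Im a *: y.
  apply/rowP => k; have /rowP/(_ k) := vA; rewrite !mxE => /(congr1 (@complex.Re _)).
  rewrite sumE mulE => <-; apply: eq_bigr => j _.
  by rewrite !mxE mulE /= mulr0 subr0.
have yA : y *m A = complex.Re a *: y + complex.Im a *: x.
  apply/rowP => k; have /rowP/(_ k) := vA; rewrite !mxE => /(congr1 (@complex.Im _)).
  rewrite sumE mulE => <-; apply: eq_bigr => j _.
  by rewrite !mxE mulE /= mulr0 add0r.
have dE (u : 'rV[R]_m) : (u *m u^T) 0 0 = \sum_j u 0 j ^+ 2.
  by rewrite mxE; apply: eq_bigr => j _; rewrite mxE.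
have d0 (u : 'rV[R]_m) : 0 <= (u *m u^T) 0 0.
  by rewrite dE sumr_ge0 // => j _; rewrite sqr_ge0.
have d_eq0 (u : 'rV[R]_m) : (u *m u^T) 0 0 = 0 -> u = 0.
  rewrite dE => /psumr_eq0P z; apply/rowP => j; apply/eqP.
  by rewrite mxE -sqrf_eq0 z // => i _; rewrite sqr_ge0.
have [xy0|xyn0] := pselect (x = 0 /\ y = 0).
  case: xy0 => x0 y0; case/eqP: v0; apply/rowP => j.
  move/rowP: x0 => /(_ j); move/rowP: y0 => /(_ j); rewrite !mxE.
  by case: (v 0 j) => ? ? /= -> ->.
(* By symmetry of A, x A y^T and y A x^T agree; expanding both gives Im a (|x|^2 + |y|^2) = 0. *)
have b0 : complex.Im a = 0.
  have symd (u z : 'rV[R]_m) : (u *m z^T) 0 0 = (z *m u^T) 0 0.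
    by rewrite !mxE; apply: eq_bigr => j _; rewrite !mxE mulrC.
  have sd : ((x *m A) *m y^T) 0 0 = ((y *m A) *m x^T) 0 0.
    by rewrite (_ : _ *m _ = x *m (y *m A)^T) 1?symd // trmx_mul symA mulmxA.
  have dl (u z t : 'rV[R]_m) r q : ((r *: u + q *: z) *m t^T) 0 0 =
      r * (u *m t^T) 0 0 + q * (z *m t^T) 0 0.
    rewrite !mxE !mulr_sumr -big_split; apply: eq_bigr => j _; rewrite !mxE /=.
    by ring.
  move: sd; rewrite xA yA -scaleNr !dl (symd x y) => /eqP.
  rewrite -subr_eq0 (_ : _ - _ = - (complex.Im a * ((x *m x^T) 0 0 + (y *m y^T) 0 0))); last by ring.
  rewrite oppr_eq0 mulf_eq0 => /orP[/eqP //|].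
  by rewrite paddr_eq0 // => /andP[/eqP/d_eq0 x0 /eqP/d_eq0 y0]; case: xyn0.
have xA' : x *m A = complex.Re a *: x by rewrite xA b0 scale0r subr0.
have yA' : y *m A = complex.Re a *: y by rewrite yA b0 scale0r addr0.
have [x0|] := eqVneq x 0; last by move=> x0; exists (complex.Re a), x.
have [y0|] := eqVneq y 0; last by move=> y0; exists (complex.Re a), y.
by case: xyn0.
Qed.

(** * Inner products and orthonormal eigenbases *)

Section InnerProduct.
Context {R : realType} {V : vectType R}.
Implicit Types (g : {dot V for idfun}) (A B P : 'End(V)).
Local Notation N := (\dim {:V}).

Lemma dot_suml g (I : Type) (r : seq I) (F : I -> V) Y :
  g (\sum_(i <- r) F i) Y = \sum_(i <- r) g (F i) Y.
Proof. by rewrite linear_sumlz. Qed.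

Lemma dot_sumr g (I : Type) (r : seq I) (F : I -> V) Y :
  g Y (\sum_(i <- r) F i) = \sum_(i <- r) g Y (F i).
Proof. by rewrite linear_sumr. Qed.

Lemma dotZl g a X Y : g (a *: X) Y = a * g X Y.
Proof. by rewrite linearZl_LR. Qed.

Lemma dotZr g a X Y : g X (a *: Y) = a * g X Y.
Proof. by rewrite linearZr_LR. Qed.

Lemma dotDl g X Y Z : g (X + Y) Z = g X Z + g Y Z.
Proof. by rewrite linearDl. Qed.

Lemma dotNl g X Z : g (- X) Z = - g X Z.
Proof. by rewrite linearNl. Qed.

Lemma dotNr g X Z : g Z (- X) = - g Z X.
Proof. by rewrite linearNr. Qed.

Lemma dot_ext g X Y : (forall Z, g X Z = g Y Z) -> X = Y.
Proof.
move=> H; apply/eqP; rewrite -subr_eq0; apply/eqP/(@dot_ndeg _ _ g) => Z.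
by rewrite dotDl dotNl H subrr.
Qed.

Lemma orthonormal_ext g (e : N.-tuple V) X Y : orthonormal g e ->
  (forall k, g X (tnth e k) = g Y (tnth e k)) -> X = Y.
Proof.
move=> oe H; rewrite (orthonormal_expand X oe) (orthonormal_expand Y oe).
by apply: eq_bigr => i _; rewrite H.
Qed.

Lemma dot_lfun_expand g (e : N.-tuple V) (A : 'End(V)) X Z : orthonormal g e ->
  g (A X) Z = \sum_i g X (tnth e i) * g (A (tnth e i)) Z.
Proof.
move=> oe; rewrite {1}(orthonormal_expand X oe) linear_sum dot_suml.
by apply: eq_bigr => i _; rewrite linearZ /= dotZl.
Qed.

(** Basis independence of the trace: the vectors of each basis are expanded in the other and the two
    sums exchanged. *)
Lemma lfun_tr_orthonormal g (e : N.-tuple V) A : orthonormal g e ->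
  lfun_tr A = \sum_i g (A (tnth e i)) (tnth e i).
Proof.
move=> oe; pose b := vbasis {:V}.
have -> : lfun_tr A = \sum_i coord b i (A b`_i).
  rewrite /lfun_tr /mxtrace; apply: eq_bigr => i _.
  by rewrite !mxE /= passmx.vecof_delta.
have bE i : b`_i = \sum_k g b`_i (tnth e k) *: tnth e k by exact: orthonormal_expand.
under eq_bigr => i _.
  rewrite bE !linear_sum /=.
  under eq_bigr => k _ do rewrite !linearZ /=.
  over.
rewrite exchange_big /=; apply: eq_bigr => k _.
rewrite [in RHS](coord_vbasis (memvf (A (tnth e k)))) dot_suml.
by apply: eq_bigr => i _; rewrite dotZl mulrC.
Qed.

Lemma lfun_trC A B : lfun_tr (A \o B)%VF = lfun_tr (B \o A)%VF.
Proof. 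
have bb : basis_of {:V} (vbasis {:V}) by exact: vbasisP.
by rewrite /lfun_tr !(passmx.mxof_comp _ _ bb) mxtrace_mulC. Qed.

Lemma orthonormal_complete g (s : seq V) : orthonormal g s ->
  (size s <= N)%N ->
  exists r, size (r ++ s) = N /\ orthonormal g (r ++ s).
Proof.
move=> os sN; have [k kE] : exists k, (k + size s = N)%N.
  by exists (N - size s)%N; rewrite subnK.
elim: k s os sN kE => [|k IH] s os sN kE; first by exists [::].
have [|v ov] := orthonormal_extend os; first by rewrite -kE addSn ltnS leq_addl.
have [||r [rs or]] := IH _ ov.
- by rewrite /= -kE addSn ltnS leq_addl.
- by rewrite /= addnS -addSn.
- by exists (rcons r v); rewrite cat_rcons.
Qed.

(** Eigenvectors are added one at a time. If s consists of orthonormal eigenvectors and r completes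
    it to a basis, symmetry of P keeps the span of r invariant, so an eigenvector of the compression
    of P to that span is one of P. *)
Lemma orthonormal_eigenbasis g P : (forall X Y, g (P X) Y = g X (P Y)) ->
  exists (e : N.-tuple V) (p : 'I_N -> R),
    orthonormal g e /\ forall i, P (tnth e i) = p i *: tnth e i.
Proof.
move=> symP.
suff [s [sN os sP]] : exists s : seq V, [/\ size s = N, orthonormal g s &
    forall v, v \in s -> exists a, P v = a *: v].
  have sP' i : exists a, P (tnth (Tuple (introT eqP sN)) i) =
      a *: tnth (Tuple (introT eqP sN)) i by apply: sP; exact: mem_tnth.
  by have [p pE] := choice sP'; exists (Tuple (introT eqP sN)), p.
have : (N <= N)%N by [].
elim: {1 3}N => [|k IH] hk; first by exists [::].
have [s [sk os sP]] := IH (ltnW hk).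
have [|r [rs or]] := orthonormal_complete os; first by rewrite sk ltnW.
pose f : N.-tuple V := Tuple (introT eqP rs).
have r0 : (0 < size r)%N.
  by move: hk; rewrite -rs size_cat sk -addn1 addnC leq_add2r.
have orr := (orthonormalE_nth g (r ++ s)).1 or.
pose M : 'M[R]_(size r) := \matrix_(i, j) g (P r`_i) r`_j.
have [|a [v [v0 vM]]] := symmetric_eigenvector (A := M) r0.
  by apply/matrixP => i j; rewrite !mxE symP dotC.
pose X := \sum_(i < size r) v 0 i *: r`_i.
(* [insub] tells whether position l lies in r: the coordinates of X are v on r and 0 on s. *)
have gX l : (l < N)%N -> g X (r ++ s)`_l =
    if insub l is Some i then v 0 i else 0.
  move=> lN; rewrite dot_suml; case: insubP => [i _ il|].
    have lr : (i < size (r ++ s))%N by rewrite rs il.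
    rewrite -{}il nth_cat ltn_ord.
    rewrite (bigD1 i) //= big1 ?addr0 => [|j ji]; rewrite dotZl.
      by have := orr i i lr lr; rewrite nth_cat ltn_ord => ->; rewrite eqxx mulr1.
    have jr : (j < size (r ++ s))%N by rewrite size_cat ltn_addr.
    have := orr j i jr lr; rewrite !nth_cat !ltn_ord => ->.
    by rewrite (negbTE ji : (nat_of_ord j == i) = false) mulr0.
  rewrite -leqNgt => lr; rewrite big1 // => i _; rewrite dotZl.
  have := orr i l; rewrite rs [in X in g X]nth_cat ltn_ord => ->; rewrite ?mulr0 //.
    by rewrite (ltn_eqF (leq_trans (ltn_ord i) lr)) mulr0.
  by rewrite -rs size_cat ltn_addr.
(* Against r this is the eigenvector equation of M; against an eigenvector in s both sides are 0,
   after moving P across g. *)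
have PX : P X = a *: X.
  apply: (orthonormal_ext (g := g) (e := f)) => // j.
  rewrite (tnth_nth 0) /= dotZl gX //.
  case: insubP => [i jr ij|]; last rewrite -leqNgt => jr.
    rewrite linear_sum dot_suml.
    have /rowP/(_ i) := vM; rewrite !mxE => <-.
    by apply: eq_bigr => l _; rewrite mxE linearZ /= dotZl nth_cat jr -ij.
  have [|b bE] := sP (r ++ s)`_j.
    by rewrite nth_cat ltnNge jr /= mem_nth // ltn_subLR // -size_cat rs.
  rewrite symP bE dotZr gX //; case: insubP => [i|]; last by rewrite !mulr0.
  by rewrite ltnNge jr.
have X0 : X != 0.
  apply: contra_neq v0 => X0; apply/rowP => i.
  have iN : (i < N)%N by rewrite -rs size_cat ltn_addr.
  have := gX i iN; rewrite X0 linear0l mxE.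
  by case: insubP => [j _ /val_inj -> <-|]; rewrite ?ltn_ord.
have gu : 0 < g X X by exact: neq0_dnorm_gt0.
exists ((Num.sqrt (g X X))^-1 *: X :: s); split => /=; first by rewrite sk.
  move: os => /andP[s1 ss]; rewrite /orthonormal /= s1 ss !andbT; apply/andP; split.
    rewrite dotZl dotZr mulrA -invfM -expr2 sqr_sqrtr ?ltW //.
    by rewrite mulVf // gt_eqF.
  apply/allP => x /(nthP 0)[i hi <-] /=; rewrite dotZl.
  have := gX (size r + i)%N; rewrite nth_cat [(_ < size r)%N]ltnNge leq_addr /= addKn => ->.
    by case: insubP => [j|]; rewrite ?mulr0 // ltnNge leq_addr.
  by rewrite -rs size_cat ltn_add2l.
move=> u; rewrite inE => /orP[/eqP->|/sP//].
by exists a; rewrite linearZ /= PX !scalerA mulrC.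
Qed.

End InnerProduct.

(** * The Chern-Ricci operator of a hermitian Lie algebra *)

Section LieBracket.
Context {R : realType} {V : vectType R}.
Implicit Types (mu : bracket V) (A B : 'End(V)).

Lemma lfun_trD A B : lfun_tr (A + B) = lfun_tr A + lfun_tr B.
Proof. by have := lfun_tr_linear 1 A B; rewrite !scale1r. Qed.

Lemma lfun_tr0 : lfun_tr (0 : 'End(V)) = 0.
Proof.
by have := lfun_trD 0 0; rewrite addr0 -{1}[lfun_tr 0]addr0 => /addrI <-.
Qed.

Lemma lfun_trN A : lfun_tr (- A) = - lfun_tr A.
Proof. by apply/eqP; rewrite -addr_eq0 -lfun_trD addNr lfun_tr0. Qed.

Lemma lfun_trZ c A : lfun_tr (c *: A) = c * lfun_tr A.
Proof. by have := lfun_tr_linear c A 0; rewrite addr0 lfun_tr0 addr0. Qed.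

Lemma skew_bracketC mu X Y : is_skew_bracket mu -> mu X Y = - mu Y X.
Proof.
move=> sk; have := sk (X + Y); rewrite !linearD /= !add_lfunE !sk add0r addr0 => /eqP.
by rewrite addrC addr_eq0 => /eqP.
Qed.

Lemma jacobi_ad mu X Y : is_lie_bracket mu ->
  mu (mu X Y) = (mu X \o mu Y)%VF - (mu Y \o mu X)%VF.
Proof.
move=> [sk jac]; apply/lfunP => Z.
rewrite add_lfunE opp_lfunE !comp_lfunE; have /eqP := jac X Y Z.
rewrite addr_eq0 => /eqP E; rewrite (skew_bracketC (mu X Y)) // -E.
by rewrite (skew_bracketC Z X) // linearN.
Qed.

Lemma lfun_tr_ad_bracket mu X Y : is_lie_bracket mu -> lfun_tr (mu (mu X Y)) = 0.
Proof. by move=> lie; rewrite jacobi_ad // lfun_trD lfun_trN lfun_trC subrr. Qed.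

End LieBracket.

Section Hermitian.
Context {R : realType} {V : vectType R}.
Variables (w : {skew_symmetric V}) (g : {dot V for idfun}).
Local Notation J := (complex_structure w g).
Implicit Types (mu : bracket V) (A B : 'End(V)).

Lemma skew_formC X Y : w X Y = - w Y X.
Proof. by rewrite hermC /= expr1 mulN1r. Qed.

Lemma dot_complexC X Y : g (J X) Y = - g X (J Y).
Proof. by rewrite -(complex_structureP w g) skew_formC (complex_structureP w g) dotC. Qed.

Hypothesis JJ : (J \o J)%VF = - \1%VF.

Lemma complex_structureK X : J (J X) = - X.
Proof. by rewrite -comp_lfunE JJ opp_lfunE id_lfunE. Qed.

Lemma dot_complex X Y : g (J X) (J Y) = g X Y.
Proof. by rewrite dot_complexC complex_structureK dotNr opprK. Qed.

Lemma dot_chern_ricci_op mu X Z : nondegenerate w ->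
  g (chern_ricci_op mu w g X) Z = chern_ricci_form mu w g X (J Z).
Proof.
by move=> ndw; rewrite chern_ricci_opP // (complex_structureP w g) dot_complex.
Qed.

Lemma chern_ricci_op_unique mu A : nondegenerate w ->
  (forall X Y, g (A X) Y = chern_ricci_form mu w g X (J Y)) ->
  chern_ricci_op mu w g = A.
Proof.
move=> ndw E; apply/lfunP => X; apply: (@dot_ext _ _ g) => Z.
by rewrite dot_chern_ricci_op.
Qed.

Definition nijenhuis_free mu :=
  forall X Y, mu (J X) (J Y) - mu X Y - J (mu (J X) Y) - J (mu X (J Y)) = 0.

(** Integrability as an identity of endomorphisms, usable under a trace; composing it with J on the
    left gives the companion form for [mu X \o J]. *)
Lemma integrable_adl mu X : nijenhuis_free mu ->
  (J \o mu (J X))%VF = (mu (J X) \o J)%VF - mu X - (J \o mu X \o J)%VF.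
Proof.
move=> N; apply/lfunP => Y; rewrite !(add_lfunE, opp_lfunE, comp_lfunE).
by apply/eqP; rewrite -subr_eq0 -oppr_eq0 -[X in _ == X](N X Y); apply/eqP;
  rewrite opprB addrAC.
Qed.

Lemma integrable_adr mu X : nijenhuis_free mu ->
  (mu X \o J)%VF = (J \o mu X)%VF - mu (J X) - (J \o mu (J X) \o J)%VF.
Proof.
move=> N; have := congr1 (fun A => J \o A)%VF (integrable_adl X N).
rewrite !comp_lfunDr !comp_lfunNr !comp_lfunA JJ !comp_lfunNl !comp_lfun1l opprK.
move=> ->; rewrite addrA [_ + (_ - (J \o mu X)%VF)]addrC subrK.
by rewrite [X in X - _]addrC addrK.
Qed.

(* With W = [JX, Y] + [X, JY], integrability gives [JX, JY] - [X, Y] = J W, and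
   the difference of the two forms is a combination of tr ad W, which vanishes
   because ad W is a sum of commutators, and tr (J ad (J W)), which vanishes by
   the operator forms of integrability above. *)
Lemma chern_ricci_form11 mu X Y : is_lie_bracket mu -> nijenhuis_free mu ->
  chern_ricci_form mu w g (J X) (J Y) = chern_ricci_form mu w g X Y.
Proof.
move=> lie N; rewrite /chern_ricci_form.
set a := mu X; set b := mu Y.
have t1 : lfun_tr (mu (J (mu (J X) (J Y)))) = lfun_tr (mu (J (mu X Y))).
  have -> : mu (J X) (J Y) = mu X Y + J (mu (J X) Y) + J (mu X (J Y)).
    by apply/eqP; rewrite -subr_eq0 !opprD !addrA N.
  rewrite !linearD /= !complex_structureK !linearN !lfun_trD !lfun_trN.
  by rewrite !lfun_tr_ad_bracket // !oppr0 !addr0.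
have t2 : lfun_tr (J \o mu (mu (J X) (J Y)))%VF = lfun_tr (J \o mu (a Y))%VF.
  rewrite !jacobi_ad // !comp_lfunDr !comp_lfunNr !lfun_trD !lfun_trN.
  have -> : lfun_tr (J \o (mu (J X) \o mu (J Y)))%VF =
      lfun_tr (mu (J X) \o J \o mu (J Y))%VF - lfun_tr (a \o mu (J Y))%VF
      - lfun_tr (J \o a \o J \o mu (J Y))%VF.
    by rewrite comp_lfunA integrable_adl // !comp_lfunDl !comp_lfunNl !lfun_trD !lfun_trN.
  have -> : lfun_tr (J \o (mu X \o mu Y))%VF =
      lfun_tr (a \o (J \o b))%VF - lfun_tr (a \o mu (J Y))%VF
      - lfun_tr (a \o (J \o mu (J Y) \o J))%VF.
    rewrite lfun_trC -[in LHS]comp_lfunA integrable_adr // !comp_lfunDr !comp_lfunNr.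
    by rewrite !lfun_trD !lfun_trN.
  (* By cyclicity, the first term produced on each side cancels against the second half of the
     commutator there, and the remaining terms match. *)
  rewrite [lfun_tr (J \o (mu (J Y) \o mu (J X)))]lfun_trC.
  rewrite -[(mu (J Y) \o mu (J X) \o J)%VF]comp_lfunA.
  rewrite [lfun_tr (mu (J Y) \o _)]lfun_trC.
  rewrite [(J \o (mu Y \o mu X))%VF]comp_lfunA [lfun_tr (J \o mu Y \o _)]lfun_trC.
  rewrite [(a \o (J \o mu (J Y) \o J))%VF]comp_lfunA.
  rewrite [lfun_tr (_ \o (J \o mu (J Y)) \o J)]lfun_trC !comp_lfunA.
  by ring.
by rewrite t1 t2.
Qed.

Section ChernRicci.
Variable mu : bracket V.
Hypotheses (ndw : nondegenerate w) (lie : is_lie_bracket mu) (N : nijenhuis_free mu).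
Local Notation P := (chern_ricci_op mu w g).

Lemma chern_ricci_op_complexC X : P (J X) = J (P X).
Proof.
apply: (@dot_ext _ _ g) => Z; rewrite dot_chern_ricci_op // dot_complexC.
rewrite dot_chern_ricci_op // -[in LHS]chern_ricci_form11 // !complex_structureK.
rewrite /chern_ricci_form !linearN /= !opp_lfunE !linearN /= !linearN /=.
by rewrite !opprK comp_lfunNr !lfun_trN; ring.
Qed.

Lemma chern_ricci_formC X Y :
  chern_ricci_form mu w g X Y = - chern_ricci_form mu w g Y X.
Proof.
rewrite /chern_ricci_form (skew_bracketC _ _ lie.1) !linearN /= !comp_lfunNr.
by rewrite !lfun_trN; ring.
Qed.

Lemma chern_ricci_op_sym X Y : g (P X) Y = g X (P Y).
Proof.
rewrite dot_chern_ricci_op // [RHS]dotC dot_chern_ricci_op //.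
rewrite [RHS]chern_ricci_formC -[LHS]chern_ricci_form11 // complex_structureK.
by rewrite /chern_ricci_form !linearN /= comp_lfunNr !lfun_trN; ring.
Qed.

End ChernRicci.
End Hermitian.

(** * Diagonal operators and conjugate brackets *)

Section DiagonalOperators.
Context {R : realType} {V : vectType R}.
Local Notation N := (\dim {:V}).
Variables (g : {dot V for idfun}) (e : N.-tuple V).
Hypothesis oe : orthonormal g e.
Local Notation E i := (tnth e i).
Implicit Types (a b p : 'I_N -> R) (A B : 'End(V)) (mu nu : bracket V).

Definition diagop a : 'End(V) :=
  linfun (fun X => \sum_i (a i * g X (E i)) *: E i).

Lemma diagopE a X : diagop a X = \sum_i (a i * g X (E i)) *: E i.
Proof.
pose f X : V := \sum_i (a i * g X (E i)) *: E i.
have lin : linear f.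
  move=> c x y; rewrite /f scaler_sumr -big_split; apply: eq_bigr => i _.
  by rewrite /= dotDl dotZl mulrDr scalerDl mulrCA scalerA.
pose lf := GRing.isLinear.Build _ _ _ _ f lin.
pose F : {linear V -> V} := HB.pack f lf.
by rewrite /diagop -[X in linfun X]/(F : _ -> _) lfunE.
Qed.

Lemma dot_basis i j : g (E i) (E j) = (i == j)%:R.
Proof. exact: (orthonormal_tnth g e).1. Qed.

Lemma dot_diagop a X k : g (diagop a X) (E k) = a k * g X (E k).
Proof.
rewrite diagopE dot_suml (bigD1 k) //= big1 => [|i /negbTE ik].
  by rewrite dotZl dot_basis eqxx mulr1 addr0.
by rewrite dotZl dot_basis ik mulr0.
Qed.

Lemma basis_ext A B : (forall i, A (E i) = B (E i)) -> A = B.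
Proof.
move=> AB; apply/lfunP => X; rewrite (orthonormal_expand X oe) !linear_sum.
by apply: eq_bigr => i _; rewrite !linearZ /= AB.
Qed.

Lemma bracket_basis_ext mu nu :
  (forall i j k, g (mu (E i) (E j)) (E k) = g (nu (E i) (E j)) (E k)) -> mu = nu.
Proof.
move=> H; apply/lfunP => X.
rewrite (orthonormal_expand X oe) !linear_sum; apply: eq_bigr => i _.
rewrite !linearZ /=; congr (_ *: _); apply: basis_ext => j.
exact: (orthonormal_ext oe).
Qed.

Lemma diagop_basis a i : diagop a (E i) = a i *: E i.
Proof.
apply: (orthonormal_ext oe) => k; rewrite dot_diagop dotZl dot_basis.
by case: eqVneq => [->|] //; rewrite !mulr0.
Qed.

Lemma diagopP A p : (forall i, A (E i) = p i *: E i) -> A = diagop p.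
Proof. by move=> H; apply: basis_ext => i; rewrite H diagop_basis. Qed.

Lemma diagopM a b X : diagop a (diagop b X) = diagop (fun i => a i * b i) X.
Proof. by apply: (orthonormal_ext oe) => k; rewrite !dot_diagop mulrA. Qed.

Lemma diagopK a b : (forall i, a i * b i = 1) -> cancel (diagop b) (diagop a).
Proof.
move=> ab X; rewrite diagopM; apply: (orthonormal_ext oe) => k.
by rewrite dot_diagop ab mul1r.
Qed.

Lemma diagop_sym a X Y : g (diagop a X) Y = g X (diagop a Y).
Proof.
rewrite [in LHS](orthonormal_expand Y oe) [in RHS](orthonormal_expand X oe).
rewrite dot_sumr dot_suml; apply: eq_bigr => i _.
rewrite dotZr dotZl dot_diagop [g (E i) _]dotC dot_diagop.
by ring.
Qed.

(** An operator commuting with [diagop p] has no entries between distinct eigenvalues, so it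
    commutes with every function of it; the second hypothesis says that a is a function of p. *)
Lemma diagop_comm p a B : (forall X, B (diagop p X) = diagop p (B X)) ->
  (forall i j, p i = p j -> a i = a j) ->
  forall X, B (diagop a X) = diagop a (B X).
Proof.
move=> Bp pa X; rewrite -!comp_lfunE; congr (fun_of_lfun _ X).
apply: basis_ext => i; rewrite !comp_lfunE diagop_basis linearZ /=.
apply: (orthonormal_ext oe) => k; rewrite dot_diagop dotZl.
have : p i * g (B (E i)) (E k) = p k * g (B (E i)) (E k).
  by rewrite -dot_diagop -Bp diagop_basis linearZ /= dotZl.
have [->|B0] := eqVneq (g (B (E i)) (E k)) 0; first by rewrite !mulr0.
by move/(mulIf B0)/pa ->.
Qed.

(** Change of basis by h. The inverse is a separate argument h', so that for diagonal h it can be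
    given by its entries. *)
Definition conj_bracket (h h' : 'End(V)) mu : bracket V :=
  linfun (fun X => (h \o mu (h' X) \o h')%VF).

Lemma conj_bracketE (h h' : 'End(V)) mu X Y :
  conj_bracket h h' mu X Y = h (mu (h' X) (h' Y)).
Proof.
pose f X : 'End(V) := (h \o mu (h' X) \o h')%VF.
have lin : linear f.
  move=> c x y; apply/lfunP => z; rewrite /f.
  by rewrite !(add_lfunE, scale_lfunE, comp_lfunE, linearP).
pose lf := GRing.isLinear.Build _ _ _ _ f lin.
pose F : {linear V -> 'End(V)} := HB.pack f lf.
by rewrite /conj_bracket -[X in linfun X]/(F : _ -> _) lfunE /= !comp_lfunE.
Qed.

Lemma conj_bracket_lie (h h' : 'End(V)) mu : cancel h h' ->
  is_lie_bracket mu -> is_lie_bracket (conj_bracket h h' mu).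
Proof.
move=> hK [sk jac]; split=> [X|X Y Z]; rewrite !conj_bracketE.
  by rewrite sk linear0.
by rewrite !hK -!linearD jac linear0.
Qed.

End DiagonalOperators.

Section ConjugateHermitian.
Context {R : realType} {V : vectType R}.
Local Notation N := (\dim {:V}).
Variables (w : {skew_symmetric V}) (g : {dot V for idfun}).
Local Notation J := (complex_structure w g).
Implicit Types (h k : 'End(V)) (mu : bracket V).

Lemma conj_bracket_integrable h k mu :
  (forall X, h (J X) = J (h X)) -> (forall X, k (J X) = J (k X)) ->
  nijenhuis_free w g mu -> nijenhuis_free w g (conj_bracket h k mu).
Proof.
move=> hJ kJ I X Y; rewrite !conj_bracketE !kJ -!hJ.
by rewrite -[RHS](linear0 h) -(I (k X) (k Y)) !linearB.
Qed.

(** The adjoint map of the new bracket at Z is the conjugate by h of that of mu at k Z. Since h and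
    k commute with J, conjugation drops out of both traces. *)
Lemma chern_ricci_form_conj h k mu X Y :
  cancel h k -> (forall X, k (J X) = J (k X)) -> (forall X, h (J X) = J (h X)) ->
  chern_ricci_form (conj_bracket h k mu) w g X Y =
  chern_ricci_form mu w g (k X) (k Y).
Proof.
move=> hK kJ hJ.
have kh : (k \o h)%VF = \1%VF by apply/lfunP => Z; rewrite comp_lfunE hK id_lfunE.
have adE Z : conj_bracket h k mu Z = (h \o mu (k Z) \o k)%VF.
  by apply/lfunP => T; rewrite conj_bracketE !comp_lfunE.
have trE A : lfun_tr (h \o A \o k)%VF = lfun_tr A.
  by rewrite lfun_trC comp_lfunA kh comp_lfun1l.
have Jh : (J \o h)%VF = (h \o J)%VF.
  by apply/lfunP => T; rewrite !comp_lfunE hJ.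
rewrite /chern_ricci_form !adE !comp_lfunE !kJ !hK trE.
by rewrite !comp_lfunA Jh -(comp_lfunA h) trE.
Qed.

Hypotheses (ndw : nondegenerate w) (JJ : (J \o J)%VF = - \1%VF).
Variables (e : N.-tuple V) (p a b : 'I_N -> R) (mu : bracket V).
Hypotheses (oe : orthonormal g e) (ab : forall i, a i * b i = 1).
Hypotheses (PE : chern_ricci_op mu w g = diagop g e p).
Hypotheses (aJ : forall X, diagop g e a (J X) = J (diagop g e a X)).
Hypotheses (bJ : forall X, diagop g e b (J X) = J (diagop g e b X)).

(** With b denoting its diagonal operator as well, g(P b X, b Y) = g(b P b X, Y) because b is
    symmetric, so the new operator is b P b. *)
Lemma chern_ricci_op_conj :
  chern_ricci_op (conj_bracket (diagop g e a) (diagop g e b) mu) w g =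
  diagop g e (fun i => b i ^+ 2 * p i).
Proof.
apply: (chern_ricci_op_unique JJ) => // X Y.
rewrite chern_ricci_form_conj //; last first.
  by apply: diagopK => // i; rewrite mulrC ab.
rewrite bJ -dot_chern_ricci_op // PE -diagop_sym // !diagopM //.
rewrite (_ : (fun i => b i ^+ 2 * p i) = (fun i => b i * p i * b i)) //.
by apply: boolp.funext => i; rewrite expr2; ring.
Qed.

End ConjugateHermitian.

(** * Convergence of brackets *)

Section BracketNorm.
Context {R : realType} {V : vectType R}.
Local Notation N := (\dim {:V}).
Variable g : {dot V for idfun}.
Implicit Types (mu nu lam : bracket V).

Lemma dot_bracket_expandl (e : N.-tuple V) mu X Y Z : orthonormal g e ->
  g (mu X Y) Z = \sum_i g X (tnth e i) * g (mu (tnth e i) Y) Z.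
Proof.
move=> oe; rewrite {1}(orthonormal_expand X oe) linear_sum sum_lfunE dot_suml.
by apply: eq_bigr => i _; rewrite linearZ /= scale_lfunE dotZl.
Qed.

Lemma dot_bracket_expand (e : N.-tuple V) mu X Y Z : orthonormal g e ->
  g (mu X Y) Z = \sum_i \sum_j \sum_k
    g X (tnth e i) * g Y (tnth e j) * g Z (tnth e k) *
    g (mu (tnth e i) (tnth e j)) (tnth e k).
Proof.
move=> oe; rewrite (dot_bracket_expandl _ _ _ _ oe); apply: eq_bigr => i _.
rewrite (dot_lfun_expand (mu _) _ _ oe) mulr_sumr; apply: eq_bigr => j _.
rewrite {1}(orthonormal_expand Z oe) dot_sumr !mulr_sumr; apply: eq_bigr => k _.
by rewrite dotZr !mulrA.
Qed.

Lemma dot_expand (e : N.-tuple V) X Y : orthonormal g e ->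
  g X Y = \sum_k g X (tnth e k) * g Y (tnth e k).
Proof.
move=> oe; rewrite {1}(orthonormal_expand Y oe) dot_sumr.
by apply: eq_bigr => k _; rewrite dotZr mulrC.
Qed.

Lemma bracket_norm_ge0 mu : 0 <= bracket_norm g mu.
Proof. exact: sqrtr_ge0. Qed.

Lemma bracket_norm_sqr (e : N.-tuple V) mu : orthonormal g e ->
  bracket_norm g mu ^+ 2 = \sum_i \sum_j \sum_k
    g (mu (tnth e i) (tnth e j)) (tnth e k) ^+ 2.
Proof.
move=> oe; rewrite (bracket_normE _ oe) sqr_sqrtr.
  apply: eq_bigr => i _; apply: eq_bigr => j _; rewrite (dot_expand _ _ oe).
  by apply: eq_bigr => k _; rewrite expr2.
apply: sumr_ge0 => i _; apply: sumr_ge0 => j _; rewrite (dot_expand _ _ oe).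
by apply: sumr_ge0 => k _; rewrite -expr2 sqr_ge0.
Qed.

Lemma bracket_norm_eq0 mu : bracket_norm g mu = 0 -> mu = 0.
Proof.
have oe := onbP g; move=> n0; apply: (bracket_basis_ext oe) => i j k.
have := bracket_norm_sqr mu oe; rewrite n0 expr0n /= => /esym z0.
have z1 : \sum_j \sum_k g (mu (tnth (onb g) i) (tnth (onb g) j)) (tnth (onb g) k) ^+ 2 = 0.
  apply: (psumr_eq0P _ z0) => // ? _.
  by do 2!apply: sumr_ge0 => ? _; rewrite sqr_ge0.
have z2 : \sum_k g (mu (tnth (onb g) i) (tnth (onb g) j)) (tnth (onb g) k) ^+ 2 = 0.
  apply: (psumr_eq0P _ z1) => // ? _.
  by apply: sumr_ge0 => ? _; rewrite sqr_ge0.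
have /eqP : g (mu (tnth (onb g) i) (tnth (onb g) j)) (tnth (onb g) k) ^+ 2 = 0.
  by apply: (psumr_eq0P _ z2) => // ? _; rewrite sqr_ge0.
by rewrite sqrf_eq0 => /eqP ->; rewrite !zero_lfunE linear0l.
Qed.

Lemma bracket_normZ a mu : bracket_norm g (a *: mu) = `|a| * bracket_norm g mu.
Proof.
apply: (@pexpIrn _ 2); rewrite ?nnegrE ?mulr_ge0 ?bracket_norm_ge0 //.
rewrite /= exprMn real_normK ?num_real // !(bracket_norm_sqr _ (onbP g)) mulr_sumr.
apply: eq_bigr => i _; rewrite mulr_sumr; apply: eq_bigr => j _.
rewrite mulr_sumr; apply: eq_bigr => k _.
by rewrite scale_lfunE scale_lfunE dotZl exprMn.
Qed.

(** Each structure constant is a single term in the sum of squares, hence bounded by the norm. *)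
Lemma dot_bracket_bound X Y Z : exists2 C, 0 <= C &
  forall mu, `|g (mu X Y) Z| <= C * bracket_norm g mu.
Proof.
have oe := onbP g; set e := onb g in oe.
exists (\sum_i \sum_j \sum_k
  `|g X (tnth e i) * g Y (tnth e j) * g Z (tnth e k)|).
  by do 3!apply: sumr_ge0 => ? _.
move=> mu; rewrite (dot_bracket_expand _ _ _ _ oe) mulr_suml.
apply: le_trans (ler_norm_sum _ _ _) _; apply: ler_sum => i _.
rewrite mulr_suml; apply: le_trans (ler_norm_sum _ _ _) _; apply: ler_sum => j _.
rewrite mulr_suml; apply: le_trans (ler_norm_sum _ _ _) _; apply: ler_sum => k _.
rewrite normrM ler_wpM2l //.
rewrite -(@ler_pXn2r _ 2) ?nnegrE ?bracket_norm_ge0 //.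
rewrite real_normK ?num_real // (bracket_norm_sqr _ oe).
rewrite (bigD1 i) //= (bigD1 j) //= (bigD1 k) //= -!addrA ler_wpDr //.
rewrite !addr_ge0 ?sumr_ge0 // => *; rewrite ?sqr_ge0 //.
- by rewrite sumr_ge0 // => *; rewrite sqr_ge0.
- by rewrite sumr_ge0 // => *; rewrite sumr_ge0 // => *; rewrite sqr_ge0.
Qed.

Section Convergence.
Context {T : Type} {F : set_system T} {FF : Filter F}.

Lemma cvg_sum_ord (n : nat) (u : 'I_n -> T -> R) (l : 'I_n -> R) :
  (forall i, u i @ F --> l i) -> (fun t => \sum_i u i t) @ F --> \sum_i l i.
Proof.
move=> H; rewrite -fct_sumE.
elim/big_ind2 : _ => //; first exact: cvg_cst.
by move=> f a h b fa hb; exact: cvgD.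
Qed.

Lemma bracket_norm_cvg (f : T -> bracket V) lam :
  (forall X Y Z, (fun t => g (f t X Y) Z) @ F --> g (lam X Y) Z) ->
  (fun t => bracket_norm g (f t)) @ F --> bracket_norm g lam.
Proof.
have oe := onbP g; set e := onb g in oe; move=> H.
pose S mu := \sum_i \sum_j \sum_k g (mu (tnth e i) (tnth e j)) (tnth e k) ^+ 2.
have SE mu : bracket_norm g mu = Num.sqrt (S mu).
  by rewrite /S -(bracket_norm_sqr _ oe) sqrtr_sqr ger0_norm ?bracket_norm_ge0.
rewrite SE (_ : (fun t => _) = (fun t => Num.sqrt (S (f t)))); last first.
  by apply: boolp.funext => t; rewrite SE.
apply: (continuous_cvg _ (@sqrt_continuous R (S lam))).
apply: cvg_sum_ord => i; apply: cvg_sum_ord => j; apply: cvg_sum_ord => k.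
by apply: cvgM; exact: H.
Qed.

(** In finite dimension, norm convergence is convergence of coefficients; limits and derivatives
    below are computed on coefficients through this. *)
Lemma bracket_cvgP f lam : bracket_cvg g F f lam <->
  forall X Y Z, (fun t => g (f t X Y) Z) @ F --> g (lam X Y) Z.
Proof.
rewrite /bracket_cvg; split => [H X Y Z|H].
  have [C C0 HC] := dot_bracket_bound X Y Z.
  apply/subr_cvg0; apply: norm_cvg0.
  apply: (@squeeze_cvgr _ _ _ _ (cst 0) (fun t => C * bracket_norm g (f t - lam))).
  - apply: nearW => t /=; rewrite normr_ge0 /=; apply: le_trans (HC _).
    by rewrite add_lfunE opp_lfunE add_lfunE opp_lfunE dotDl dotNl.
  - exact: cvg_cst.
  - by rewrite -(mulr0 C); apply: cvgM => //; exact: cvg_cst.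
have n0 : bracket_norm g (0 : bracket V) = 0.
  by rewrite -(scale0r (0 : bracket V)) bracket_normZ normr0 mul0r.
rewrite -[X in _ --> X]n0; apply: bracket_norm_cvg => X Y Z.
rewrite (_ : (fun _ => _) = (fun t => g (f t X Y) Z - g (lam X Y) Z)); last first.
  apply: boolp.funext => t.
  by rewrite add_lfunE opp_lfunE add_lfunE opp_lfunE dotDl dotNl.
by rewrite !zero_lfunE linear0l; apply/subr_cvg0; exact: H.
Qed.

End Convergence.
End BracketNorm.

(** * Polynomial functions of the bracket *)

Section PolynomialFunctions.
Context {R : realType} {V : vectType R}.
Local Notation N := (\dim {:V}).
Variable g : {dot V for idfun}.
Implicit Types (mu nu lam : bracket V) (phi psi : bracket V -> R).

(** An inductive closure rather than polynomials in coordinates: continuity and local Lipschitz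
    bounds follow by induction. *)
Inductive polyfun : (bracket V -> R) -> Prop :=
| polyfun_cst c : polyfun (fun=> c)
| polyfun_coef X Y Z : polyfun (fun mu => g (mu X Y) Z)
| polyfunD phi psi : polyfun phi -> polyfun psi ->
    polyfun (fun mu => phi mu + psi mu)
| polyfunM phi psi : polyfun phi -> polyfun psi ->
    polyfun (fun mu => phi mu * psi mu).

Lemma polyfunZ c phi : polyfun phi -> polyfun (fun mu => c * phi mu).
Proof. by apply: polyfunM; exact: polyfun_cst. Qed.

Lemma polyfunN phi : polyfun phi -> polyfun (fun mu => - phi mu).
Proof.
move=> pf; rewrite (_ : (fun _ => _) = (fun mu => -1 * phi mu)).
  exact: polyfunZ.
by apply: boolp.funext => mu; rewrite mulN1r.
Qed.

Lemma polyfun_sum (I : Type) (r : seq I) (F : I -> bracket V -> R) :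
  (forall i, polyfun (F i)) -> polyfun (fun mu => \sum_(i <- r) F i mu).
Proof.
move=> pF; rewrite (_ : (fun _ => _) = \sum_(i <- r) F i).
  elim: r => [|i r IH]; first by rewrite big_nil; exact: polyfun_cst.
  by rewrite big_cons; exact: polyfunD.
by apply: boolp.funext => mu; rewrite fct_sumE.
Qed.

(** This shape covers both traces of the Chern-Ricci form, with one of A and B equal to J and the
    other to the identity. *)
Lemma polyfun_comp_l (A B : 'End(V)) X Y Z U :
  polyfun (fun mu => g (A (mu (B (mu X Y)) Z)) U).
Proof.
have oe := onbP g.
rewrite (_ : (fun _ => _) = (fun mu => \sum_i
    (\sum_k g (mu X Y) (tnth (onb g) k) * g (B (tnth (onb g) k)) (tnth (onb g) i)) *
    \sum_k g (mu (tnth (onb g) i) Z) (tnth (onb g) k) * g (A (tnth (onb g) k)) U)).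
  apply: polyfun_sum => i; apply: polyfunM; apply: polyfun_sum => k;
    by apply: polyfunM; first [exact: polyfun_coef | exact: polyfun_cst].
apply: boolp.funext => mu.
rewrite (dot_lfun_expand A _ _ oe).
under eq_bigr => k _ do rewrite (dot_bracket_expandl _ _ _ _ oe) mulr_suml.
rewrite exchange_big /=; apply: eq_bigr => i _.
rewrite mulr_sumr; apply: eq_bigr => k _.
by rewrite (dot_lfun_expand B _ _ oe) mulrA.
Qed.

Lemma polyfun_comp_r X Y Z U : polyfun (fun mu => g (mu Z (mu X Y)) U).
Proof.
rewrite (_ : (fun _ => _) = (fun mu => \sum_i
    g (mu X Y) (tnth (onb g) i) * g (mu Z (tnth (onb g) i)) U)).
  by apply: polyfun_sum => i; apply: polyfunM; exact: polyfun_coef.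
by apply: boolp.funext => mu; rewrite (dot_lfun_expand _ _ _ (onbP g)).
Qed.

Lemma polyfun_lfun (A : 'End(V)) X Y Z : polyfun (fun mu => g (A (mu X Y)) Z).
Proof.
rewrite (_ : (fun _ => _) = (fun mu => \sum_i
    g (mu X Y) (tnth (onb g) i) * g (A (tnth (onb g) i)) Z)).
  by apply: polyfun_sum => i; apply: polyfunM;
    first [exact: polyfun_coef | exact: polyfun_cst].
by apply: boolp.funext => mu; rewrite (dot_lfun_expand A _ _ (onbP g)).
Qed.

Lemma polyfun_cvg phi (T : Type) (F : set_system T) (FF : Filter F) f lam :
  polyfun phi -> bracket_cvg g F f lam -> (fun t => phi (f t)) @ F --> phi lam.
Proof.
move=> pf fl; elim: pf => [c|X Y Z|p q _ IHp _ IHq|p q _ IHp _ IHq].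
- exact: cvg_cst.
- exact: (bracket_cvgP g f lam).1.
- exact: cvgD.
- exact: cvgM.
Qed.

(** The bound and the Lipschitz estimate are proved together because the estimate for a product
    needs the bounds of its factors. *)
Lemma polyfun_lipschitz phi M : polyfun phi -> exists2 K, 0 <= K &
  forall mu nu, bracket_norm g mu <= M -> bracket_norm g nu <= M ->
    `|phi mu| <= K /\ `|phi mu - phi nu| <= K * bracket_norm g (mu - nu).
Proof.
elim=> [c|X Y Z|p q _ [K K0 HK] _ [L L0 HL]|p q _ [K K0 HK] _ [L L0 HL]].
- exists `|c| => // mu nu _ _; split=> //.
  by rewrite subrr normr0 mulr_ge0 ?bracket_norm_ge0.
- have [C C0 HC] := dot_bracket_bound g X Y Z.
  exists (Num.max C (C * M)); first by rewrite le_max C0.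
  move=> mu nu m n; split.
    by rewrite le_max; apply/orP; right; rewrite (le_trans (HC mu)) // ler_wpM2l.
  have -> : g (mu X Y) Z - g (nu X Y) Z = g ((mu - nu) X Y) Z.
    by rewrite add_lfunE opp_lfunE add_lfunE opp_lfunE dotDl dotNl.
  by apply: le_trans (HC _) _; rewrite ler_wpM2r ?bracket_norm_ge0 // le_max lexx.
- exists (K + L) => [|mu nu m n]; first exact: addr_ge0.
  have [a b] := HK _ _ m n; have [c d] := HL _ _ m n; split.
    by rewrite (le_trans (ler_normD _ _)) // lerD.
  by rewrite opprD addrACA mulrDl (le_trans (ler_normD _ _)) // lerD.
- exists (K * L + (K * L + L * K)) => [|mu nu m n].
    by rewrite !addr_ge0 // mulr_ge0.
  have [a b] := HK _ _ m n; have [c d] := HL _ _ m n; split.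
    by rewrite normrM (le_trans (ler_pM _ _ a c)) // lerDl addr_ge0 // mulr_ge0.
  have [e _] := HL _ _ n m; have D0 := bracket_norm_ge0 g (mu - nu).
  have -> : p mu * q mu - p nu * q nu = p mu * (q mu - q nu) + (p mu - p nu) * q nu.
    by ring.
  apply: le_trans (ler_normD _ _) _; rewrite !normrM mulrDl.
  have h1 : `|p mu| * `|q mu - q nu| <= K * L * bracket_norm g (mu - nu).
    by rewrite -mulrA ler_pM.
  have h2 : `|p mu - p nu| * `|q nu| <= L * K * bracket_norm g (mu - nu).
    by rewrite -mulrA mulrC ler_pM.
  have h3 : 0 <= K * L * bracket_norm g (mu - nu) by rewrite !mulr_ge0.
  rewrite mulrDl; lra.
Qed.

End PolynomialFunctions.

Section FlowPolynomial.
Context {R : realType} {V : vectType R}.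
Local Notation N := (\dim {:V}).
Variables (w : {skew_symmetric V}) (g : {dot V for idfun}).
Local Notation J := (complex_structure w g).
Hypotheses (ndw : nondegenerate w) (JJ : (J \o J)%VF = - \1%VF).

(** The choice made in [form_op] disappears once the operator is paired through g: what remains is
    the form at (X, J Z), two traces that expand over an orthonormal basis. *)
Lemma polyfun_chern_ricci_op X Z :
  polyfun g (fun mu => g (chern_ricci_op mu w g X) Z).
Proof.
have oe := onbP g; set e := onb g in oe.
rewrite (_ : (fun _ => _) = (fun mu : bracket V =>
   - 2^-1 * (\sum_i g (J (mu (\1%VF (mu X (J Z))) (tnth e i))) (tnth e i))
   + 2^-1 * (\sum_i g (\1%VF (mu (J (mu X (J Z))) (tnth e i))) (tnth e i)))).
  by apply: polyfunD; apply: polyfunZ; apply: polyfun_sum => i; exact: polyfun_comp_l.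
apply: boolp.funext => mu; rewrite dot_chern_ricci_op // /chern_ricci_form.
rewrite !(lfun_tr_orthonormal _ oe); congr (_ * _ + _ * _).
  by apply: eq_bigr => i _; rewrite !id_lfunE comp_lfunE.
by apply: eq_bigr => i _; rewrite !id_lfunE.
Qed.

Lemma polyfun_flow X Y Z :
  polyfun g (fun mu => g (delta mu (chern_ricci_op mu w g) X Y) Z).
Proof.
have oe := onbP g; set e := onb g in oe.
rewrite (_ : (fun _ => _) = (fun mu : bracket V =>
  (\sum_i g (chern_ricci_op mu w g X) (tnth e i) * g (mu (tnth e i) Y) Z) +
  (\sum_i g (chern_ricci_op mu w g Y) (tnth e i) * g (mu X (tnth e i)) Z) +
  - (\sum_i g (mu X Y) (tnth e i) * g (chern_ricci_op mu w g (tnth e i)) Z))).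
  by apply: polyfunD; first apply: polyfunD; last apply: polyfunN;
    apply: polyfun_sum => i; apply: polyfunM;
    first [exact: polyfun_coef | exact: polyfun_chern_ricci_op].
apply: boolp.funext => mu; rewrite deltaE !dotDl dotNl; congr (_ + _ + - _).
- exact: dot_bracket_expandl.
- exact: dot_lfun_expand.
- exact: dot_lfun_expand.
Qed.

End FlowPolynomial.

(** * Differentiable curves of brackets *)

Section Derivative.
Context {R : realType} {V : vectType R}.
Variable g : {dot V for idfun}.
Implicit Types (f : R -> bracket V) (nu : bracket V).

Lemma dot_bracket_quotient f t X Y Z :
  (fun h : R => h^-1 *: (((fun s => g (f s X Y) Z) \o shift t) (h *: 1)
    - g (f t X Y) Z)) = (fun h => g ((h^-1 *: (f (t + h) - f t)) X Y) Z).
Proof.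
apply: boolp.funext => h /=.
have -> : h *: (1 : R) + t = t + h by rewrite [h *: 1]mulr1 addrC.
rewrite scale_lfunE scale_lfunE dotZl add_lfunE opp_lfunE add_lfunE opp_lfunE.
by rewrite dotDl dotNl.
Qed.

Lemma bracket_is_deriveP f t nu : bracket_is_derive g f t nu <->
  forall X Y Z, is_derive t 1 (fun s => g (f s X Y) Z) (g (nu X Y) Z).
Proof.
rewrite /bracket_is_derive; split.
  move=> /(bracket_cvgP g) H X Y Z.
  have D : derivable (fun s => g (f s X Y) Z) t 1.
    by apply/cvg_ex; exists (g (nu X Y) Z); rewrite dot_bracket_quotient; exact: H.
  apply: DeriveDef => //; rewrite /derive dot_bracket_quotient.
  by apply/cvg_lim => //; exact: H.
move=> H; apply/bracket_cvgP => X Y Z; have [D <-] := H X Y Z.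
by rewrite -dot_bracket_quotient; exact: D.
Qed.

Lemma bracket_derive_cvg f t nu : bracket_is_derive g f t nu ->
  bracket_cvg g (nbhs t) f (f t).
Proof.
move=> /bracket_is_deriveP D; apply/bracket_cvgP => X Y Z.
have [d _] := D X Y Z.
by have /derivable1_diffP/differentiable_continuous := d.
Qed.

End Derivative.

(** * Uniqueness for ordinary differential equations *)

Section Gronwall.
Context {R : realType}.

(** The function d(s) exp(- K s) has nonpositive derivative. *)
Lemma gronwall (d dd : R -> R) (K : R) :
  (forall s : R, 0 <= s <= 1 -> is_derive s 1 d (dd s) /\ dd s <= K * d s) ->
  d 0 = 0 -> d 1 <= 0.
Proof.
move=> H d0; pose f s := d s * expR (- K * s).
have df (s : R) : 0 <= s <= 1 ->
    is_derive s 1 f (d s * (expR (- K * s) * - K) + expR (- K * s) * dd s).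
  move=> /H[ds _].
  have l : is_derive s 1 (fun s : R => - K * s) (- K).
    have := @is_deriveZ R R^o R^o id (- K) s 1 1 _.
    by rewrite [_ *: 1]mulr1; apply.
  have e : is_derive s 1 (fun s : R => expR (- K * s)) (expR (- K * s) * - K).
    exact: (@is_derive1_comp _ expR (fun s => - K * s)).
  exact: is_deriveM.
have f1 : f 1 <= f 0.
  apply: (@ler0_derive1_le_cc R f 0 1); rewrite ?in_itv /= ?lexx ?ler01 //.
  - by move=> s; rewrite in_itv /= => /andP[/ltW a /ltW b]; have [] := df s; rewrite ?a.
  - move=> s; rewrite in_itv /= => /andP[/ltW a /ltW b].
    have ab : 0 <= s <= 1 by rewrite a.
    rewrite derive1E; have [_ ->] := df s ab; have [_ l] := H s ab.
    have e0 := expR_ge0 (- K * s).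
    rewrite (_ : _ + _ = expR (- K * s) * (dd s - K * d s)); last by ring.
    by rewrite mulr_ge0_le0 // subr_le0.
  - apply: continuous_in_subspaceT => s; rewrite inE /= in_itv /= => ab.
    by have [/derivable1_diffP/differentiable_continuous] := df s ab.
by move: f1; rewrite /f d0 mul0r pmulr_lle0 ?expR_gt0.
Qed.

End Gronwall.

Section Uniqueness.
Context {R : realType} {V : vectType R}.
Local Notation N := (\dim {:V}).
Variables (g : {dot V for idfun}) (F : bracket V -> bracket V).
Hypothesis polyF : forall X Y Z, polyfun g (fun mu => g (F mu X Y) Z).

(* Parametrizing the segment from 0 to t by [0, 1] treats both signs of t at once. *)
Lemma ode_unique (x y : R -> bracket V) (t : R) :
  (forall s : R, 0 <= s <= 1 -> bracket_is_derive g x (s * t) (F (x (s * t))) /\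
    bracket_is_derive g y (s * t) (F (y (s * t)))) ->
  x 0 = y 0 -> x t = y t.
Proof.
move=> H xy0; have oe := onbP g; set e := onb g in oe.
(* Squaring makes the distance a sum of squares of coefficients, differentiable even where the
   curves meet. *)
pose D s := bracket_norm g (x (s * t) - y (s * t)) ^+ 2.
have mt (s : R) : is_derive s 1 (fun s => s * t) t.
  have := @is_deriveZ R R^o R^o id t s 1 1 _.
  rewrite [_ *: 1]mulr1 (_ : t \*: id = (fun s => s * t)); first by apply.
  by apply: boolp.funext => u; rewrite mulrC.
(* Compactness of [0, 1] confines both curves to a ball, on which the vector field is Lipschitz. *)
have bounded_curve (z : R -> bracket V) :
    (forall s : R, 0 <= s <= 1 -> bracket_is_derive g z (s * t) (F (z (s * t)))) ->
    exists M, forall s : R, 0 <= s <= 1 -> bracket_norm g (z (s * t)) <= M.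
  move=> dz; pose n s := bracket_norm g (z (s * t)).
  have [|c _ cM] := @EVT_max R n 0 1 ler01; last first.
    by exists (n c) => s s01; apply: cM; rewrite in_itv.
  apply: continuous_in_subspaceT => s; rewrite inE /= in_itv /= => ab.
  apply: bracket_norm_cvg => X Y Z.
  have /(bracket_is_deriveP g)/(_ X Y Z)[d _] := dz s ab.
  have [/derivable1_diffP/differentiable_continuous cm _] := mt s.
  have /derivable1_diffP/differentiable_continuous cz := d.
  exact: (continuous_comp cm cz).
have [M hM] : exists M, forall s : R, 0 <= s <= 1 ->
    bracket_norm g (x (s * t)) <= M /\ bracket_norm g (y (s * t)) <= M.
  have [|A hA] := bounded_curve x; first by move=> s /H[].
  have [|B hB] := bounded_curve y; first by move=> s /H[].
  by exists (Num.max A B) => s s01; rewrite !le_max hA // hB // orbT.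
(* The derivative of u is bounded by a multiple of the whole D, not of u itself, so the property
   passes to sums and can be checked on one coefficient. *)
pose good (u : R -> R) := exists u' K, forall s : R, 0 <= s <= 1 ->
  is_derive s 1 u (u' s) /\ u' s <= K * D s.
have good_sum (G : 'I_N -> R -> R) : (forall i, good (G i)) ->
    good (fun s => \sum_i G i s).
  move=> gG; rewrite -fct_sumE; elim/big_ind: _ => //.
    exists (fun=> 0), 0 => s _; rewrite mul0r; split=> //; exact: is_derive_cst.
  move=> u v [u' [K HK]] [v' [L HL]]; exists (fun s => u' s + v' s), (K + L).
  move=> s s01; have [du lu] := HK s s01; have [dv lv] := HL s s01.
  by rewrite mulrDl lerD //; split=> //; exact: is_deriveD.
suff [D' [K DK]] : good D.
  have D1 : D 1 <= 0.
    apply: (@gronwall _ D D' K) => //.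
    by rewrite /D !mul0r xy0 subrr -(scale0r 0) bracket_normZ normr0 mul0r expr0n.
  have /eqP : D 1 = 0 by apply/eqP; rewrite eq_le D1 sqr_ge0.
  rewrite sqrf_eq0 !mul1r => /eqP/bracket_norm_eq0/eqP.
  by rewrite subr_eq0 => /eqP.
have -> : D = fun s => \sum_i \sum_j \sum_k
    g ((x (s * t) - y (s * t)) (tnth e i) (tnth e j)) (tnth e k) ^+ 2.
  by apply: boolp.funext => s; rewrite /D (bracket_norm_sqr _ oe).
apply: (good_sum) => i; apply: (good_sum) => j; apply: (good_sum) => k.
move: (tnth e i) (tnth e j) (tnth e k) => X Y Z.
have [K K0 HK] := polyfun_lipschitz M (polyF X Y Z).
have [C C0 HC] := dot_bracket_bound g X Y Z.
pose c (mu : bracket V) := g (mu X Y) Z.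
have cB mu nu : c (mu - nu) = c mu - c nu.
  by rewrite /c add_lfunE opp_lfunE add_lfunE opp_lfunE dotDl dotNl.
exists (fun s => 2 * (c (x (s * t)) - c (y (s * t))) *
  (t * (c (F (x (s * t))) - c (F (y (s * t)))))), (2 * C * `|t| * K).
move=> s s01; have [dx dy] := H s s01; have [mx my] := hM s s01; split.
  have dc z : bracket_is_derive g z (s * t) (F (z (s * t))) ->
      is_derive s 1 (fun s => c (z (s * t))) (c (F (z (s * t))) * t).
    move=> /(bracket_is_deriveP g)/(_ X Y Z) dz.
    exact: (@is_derive1_comp _ (fun r => c (z r)) (fun s => s * t)).
  have dd := is_deriveB (dc _ dx) (dc _ dy).
  have d2 := is_deriveM dd dd.
  rewrite (_ : (fun _ => _) = ((fun s => c (x (s * t))) - (fun s => c (y (s * t)))) *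
      ((fun s => c (x (s * t))) - (fun s => c (y (s * t))))).
    apply: is_derive_eq; rewrite /GRing.scale /=.
    by rewrite -[(_ - _) s]/(c (x (s * t)) - c (y (s * t))); ring.
  by apply: boolp.funext => r; rewrite -[g _ Z]/(c (x (r * t) - y (r * t))) cB expr2.
have [_ l2] := HK _ _ mx my.
have l1 := HC (x (s * t) - y (s * t)); rewrite -/(c _) cB in l1.
rewrite /D expr2; set n := bracket_norm _ _ in l1 l2 *.
apply: le_trans (ler_norm _) _; rewrite !normrM normr_nat.
rewrite (_ : 2 * C * `|t| * K * (n * n) = 2 * (C * n) * (`|t| * (K * n))); last by ring.
by rewrite ler_pM ?mulr_ge0 // ?ler_wpM2l.
Qed.

End Uniqueness.

(** * The explicit solution of the bracket flow *)

Lemma cvg_near_eq (R : realType) (T : Type) (F : set_system T) (FF : Filter F)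
    (u v : T -> R) (l : R) :
  (\forall t \near F, u t = v t) -> v @ F --> l -> u @ F --> l.
Proof. by move=> uv; apply: cvg_trans; apply: near_eq_cvg; apply: filterS uv. Qed.

Section BasisConvergence.
Context {R : realType} {V : vectType R}.
Local Notation N := (\dim {:V}).
Variables (g : {dot V for idfun}) (e : N.-tuple V).
Hypothesis oe : orthonormal g e.
Local Notation E i := (tnth e i).

Lemma bracket_cvg_near_eq (T : Type) (F : set_system T) (FF : Filter F)
    (u v : T -> bracket V) (lam : bracket V) :
  (\forall t \near F, u t = v t) -> bracket_cvg g F v lam -> bracket_cvg g F u lam.
Proof.
by move=> uv; rewrite /bracket_cvg; apply: cvg_near_eq; apply: filterS uv => t ->.
Qed.

Lemma bracket_cvg_basis (T : Type) (F : set_system T) (FF : Filter F)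
    (f : T -> bracket V) (lam : bracket V) :
  (forall i j k, (fun t => g (f t (E i) (E j)) (E k)) @ F -->
     g (lam (E i) (E j)) (E k)) ->
  bracket_cvg g F f lam.
Proof.
move=> H; apply/bracket_cvgP => X Y Z.
rewrite (dot_bracket_expand lam _ _ _ oe).
rewrite (_ : (fun t => _) = (fun t => \sum_i \sum_j \sum_k
    g X (E i) * g Y (E j) * g Z (E k) * g (f t (E i) (E j)) (E k))); last first.
  by apply: boolp.funext => t; rewrite (dot_bracket_expand _ _ _ _ oe).
apply: cvg_sum_ord => i; apply: cvg_sum_ord => j; apply: cvg_sum_ord => k.
by apply: cvgM; [exact: cvg_cst | exact: H].
Qed.

Lemma bracket_is_derive_basis (f : R -> bracket V) (t : R) (nu : bracket V) :
  (forall i j k, is_derive t 1 (fun s => g (f s (E i) (E j)) (E k))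
     (g (nu (E i) (E j)) (E k))) ->
  bracket_is_derive g f t nu.
Proof.
move=> H; apply: bracket_cvg_basis => i j k; have [D <-] := H i j k.
rewrite -dot_bracket_quotient; exact: D.
Qed.

End BasisConvergence.

Section ExplicitFlow.
Context {R : realType} {V : vectType R}.
Local Notation N := (\dim {:V}).
Variables (w : {skew_symmetric V}) (g : {dot V for idfun}).
Local Notation J := (complex_structure w g).
Local Notation P mu := (chern_ricci_op mu w g).
Hypotheses (ndw : nondegenerate w) (JJ : (J \o J)%VF = - \1%VF).
Variables (mu0 : bracket V) (e : N.-tuple V) (p : 'I_N -> R).
Hypotheses (lie0 : is_lie_bracket mu0) (int0 : nijenhuis_free w g mu0).
Hypotheses (oe : orthonormal g e) (PE : P mu0 = diagop g e p).
Local Notation E i := (tnth e i).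

Definition flow_eigen (t : R) i := 1 - 2 * t * p i.
Definition admissible (t : R) := forall i, 0 < flow_eigen t i.
Local Notation h t := (fun i => Num.sqrt (flow_eigen t i)).

(** Meaningful at admissible t only; elsewhere the square roots or inverses may take default
    values. *)
Definition explicit_flow (t : R) : bracket V :=
  conj_bracket (diagop g e (h t)) (diagop g e (fun i => (h t i)^-1)) mu0.

Lemma explicit_flowE t i j k : g (explicit_flow t (E i) (E j)) (E k) =
  h t k * (h t i * h t j)^-1 * g (mu0 (E i) (E j)) (E k).
Proof.
rewrite conj_bracketE // dot_diagop // !diagop_basis // !linearZ /=.
by rewrite scale_lfunE !dotZl invfM; ring.
Qed.

Lemma explicit_flow0 : explicit_flow 0 = mu0.
Proof.
apply: (bracket_basis_ext oe) => i j k; rewrite explicit_flowE /flow_eigen.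
by rewrite !mulr0 !mul0r !subr0 sqrtr1 !mulr1 invr1 !mul1r.
Qed.

(** J commutes with P, hence with every function of P. *)
Lemma diagop_complexC a : (forall i j, p i = p j -> a i = a j) ->
  forall X, diagop g e a (J X) = J (diagop g e a X).
Proof.
move=> pa X; apply/esym/(diagop_comm oe (p := p)) => // Y.
by rewrite -PE chern_ricci_op_complexC.
Qed.

Section Admissible.
Variable t : R.
Hypothesis adm : admissible t.

Lemma sqrt_flow_eigen_gt0 i : 0 < h t i.
Proof. by rewrite sqrtr_gt0. Qed.

Lemma explicit_flow_lie : is_lie_bracket (explicit_flow t).
Proof.
apply: conj_bracket_lie lie0; apply: diagopK => // i.
by rewrite mulVf // gt_eqF // sqrt_flow_eigen_gt0.
Qed.

Lemma explicit_flow_integrable : nijenhuis_free w g (explicit_flow t).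
Proof.
by apply: conj_bracket_integrable => //; apply: diagop_complexC => i j;
  rewrite /flow_eigen => ->.
Qed.

Lemma chern_ricci_op_explicit_flow :
  P (explicit_flow t) = diagop g e (fun i => p i / flow_eigen t i).
Proof.
rewrite (chern_ricci_op_conj ndw JJ oe _ PE) //.
- congr diagop; apply: boolp.funext => i.
  by rewrite exprVn sqr_sqrtr ?ltW // mulrC.
- by move=> i; rewrite mulfV // gt_eqF // sqrt_flow_eigen_gt0.
- by apply: diagop_complexC => i j; rewrite /flow_eigen => ->.
- by apply: diagop_complexC => i j; rewrite /flow_eigen => ->.
Qed.

Lemma is_derive_sqrt_flow_eigen i :
  is_derive t 1 (fun s => h s i) (- p i / h t i).
Proof.
have l : is_derive t 1 (fun s => flow_eigen s i) (- (2 * p i)).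
  have := is_deriveD (is_derive_cst (1 : R) t 1)
    (@is_deriveZ R R^o R^o id (- (2 * p i)) t 1 1 _).
  rewrite [_ *: 1]mulr1 add0r (_ : _ + _ = (fun s => flow_eigen s i)); first by apply.
  apply: boolp.funext => s; rewrite /flow_eigen !fctE /=.
  by rewrite -[- (2 * p i) *: s]/(- (2 * p i) * s); ring.
have d := @is_derive1_comp _ Num.sqrt (fun s => flow_eigen s i) t _ _
  (is_derive1_sqrt (adm i)) l.
apply: (is_derive_eq d).
by have h0 := sqrt_flow_eigen_gt0 i; field; rewrite gt_eqF.
Qed.

Lemma explicit_flow_derive :
  bracket_is_derive g explicit_flow t (delta (explicit_flow t) (P (explicit_flow t))).
Proof.
apply: (bracket_is_derive_basis oe) => i j k.
rewrite chern_ricci_op_explicit_flow deltaE dotDl dotDl dotNl !diagop_basis //.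
rewrite dot_diagop // !linearZ /= scale_lfunE !dotZl explicit_flowE.
have hE l : flow_eigen t l = h t l ^+ 2 by rewrite sqr_sqrtr // ltW.
have h0 l : h t l != 0 by rewrite gt_eqF // sqrt_flow_eigen_gt0.
have d1 := is_deriveM (is_derive_sqrt_flow_eigen i) (is_derive_sqrt_flow_eigen j).
have nz : ((fun s => h s i) * (fun s => h s j)) t != 0 := mulf_neq0 (h0 i) (h0 j).
have d2 := is_deriveV nz d1.
have d3 := is_deriveM (is_derive_sqrt_flow_eigen k) d2.
have d4 := is_deriveM d3 (is_derive_cst (g (mu0 (E i) (E j)) (E k)) t 1).
rewrite (_ : (fun s => _) = ((fun s => h s k) * (fun s => (h s i * h s j)^-1)) *
    cst (g (mu0 (E i) (E j)) (E k))); last first.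
  by apply: boolp.funext => s; rewrite explicit_flowE.
apply: (is_derive_eq d4).
rewrite /GRing.scale /= !fctE.
(* With every 1 - 2 t p_l replaced by the square of its root, the identity is rational in the three
   roots. *)
move: (hE i) (hE j) (hE k) (h0 i) (h0 j) (h0 k).
move: (h t i) (h t j) (h t k) => x y z -> -> -> x0 y0 z0.
by field; rewrite x0 y0 z0.
Qed.

End Admissible.

Section Solution.
Variables (a b : \bar R) (mu : R -> bracket V).
Hypotheses (ab : (a < 0 < b)%E) (mu00 : mu 0 = mu0).
Hypothesis flow : is_bracket_flow w g a b mu.

(** A convex combination of the values at times 0 and t when 0 <= s <= 1, so the admissible times
    are star-shaped about 0. *)
Lemma flow_eigenM (s t : R) i : flow_eigen (s * t) i = (1 - s) + s * flow_eigen t i.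
Proof. by rewrite /flow_eigen; ring. Qed.

Lemma flow_segment (s t : R) : (a < t%:E < b)%E -> 0 <= s <= 1 ->
  (a < (s * t)%:E < b)%E.
Proof.
case/andP: ab => a0 b0 /andP[at_ tb] /andP[s0 s1]; apply/andP; split.
  case: (leP 0 t) => t0.
    by apply: lt_le_trans a0 _; rewrite lee_fin mulr_ge0.
  by apply: lt_le_trans at_ _; rewrite lee_fin; nra.
case: (leP t 0) => t0.
  by apply: le_lt_trans b0; rewrite lee_fin; nra.
by apply: le_lt_trans tb; rewrite lee_fin; nra.
Qed.

Lemma flow_eq_explicit_admissible (t : R) : (a < t%:E < b)%E -> admissible t ->
  mu t = explicit_flow t.
Proof.
move=> tab adm; apply: (@ode_unique R V g (fun nu => delta nu (P nu))).
- by move=> *; exact: polyfun_flow.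
- move=> s s01; split; first by have [] := flow (flow_segment tab s01).
  apply: explicit_flow_derive => i; rewrite flow_eigenM.
  case/andP: s01 => s0 s1; have := adm i => Hi; nra.
- by rewrite explicit_flow0.
Qed.

(* If 1 - 2 t p_i reached 0 first at time s0 * t, the entry p_i / (1 - 2 s t p_i)
   of the Chern-Ricci operator would blow up as s tends to s0 from below,
   although it is a polynomial function of a bracket continuous at s0 * t. *)
Lemma flow_admissible (t : R) : (a < t%:E < b)%E -> admissible t.
Proof.
move=> tab i; rewrite ltNge; apply/negP => Hi.
(* Along the ray s * t, the entry 1 - s M of an index maximizing 2 t p_j vanishes first, at s0 = 1 /
   M. *)
have [i0 _ i0M] := @arg_maxP _ _ _ i xpredT (fun j => 2 * t * p j) isT.
set M := 2 * t * p i0 in i0M.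
have M1 : 1 <= M by apply: le_trans (i0M i isT); move: Hi; rewrite /flow_eigen; lra.
have M0 : 0 < M by lra.
pose s0 := M^-1.
have s01 : 0 <= s0 <= 1 by rewrite invr_ge0 ltW //= invf_le1.
have cmu : bracket_cvg g s0^'- (fun s => mu (s * t)) (mu (s0 * t)).
  apply/bracket_cvgP => X Y Z.
  have [_ /bracket_derive_cvg/(bracket_cvgP g)/(_ X Y Z) c] :=
    flow (flow_segment tab s01).
  apply: (@cvg_comp _ _ _ (fun s => s * t) (fun r => g (mu r X Y) Z)); last exact: c.
  by apply: cvgM; [apply: cvg_at_left_filter; exact: cvg_id | exact: cvg_cst].
have FF : Filter s0^'- by exact: _.
have cP := polyfun_cvg FF (polyfun_chern_ricci_op ndw JJ (E i0) (E i0)) cmu.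
have cM : (fun s => 1 - s * M) @ s0^'- --> 0.
  rewrite -[X in _ --> X](subrr 1) -[X in _ --> _ - X](mulVf (lt0r_neq0 M0)).
  apply: cvgB; first exact: cvg_cst.
  by apply: cvgM; [apply: cvg_at_left_filter; exact: cvg_id | exact: cvg_cst].
(* For s < s0 this product is constantly p_i0, so its limit 0 forces p_i0 = 0, against M > 0. *)
have c0 : (fun s => (1 - s * M) * g (P (mu (s * t)) (E i0)) (E i0)) @ s0^'- --> (0 : R).
  rewrite -[X in _ --> X](mul0r (g (P (mu (s0 * t)) (E i0)) (E i0))).
  exact: cvgM cM cP.
have c1 : (fun=> p i0) @ s0^'- --> (0 : R).
  apply: cvg_near_eq c0; near=> s; apply/esym.
  have s_gt0 : 0 < s by near: s; apply: nbhs_left_gt; rewrite invr_gt0.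
  have ss0 : s < s0 by near: s; exact: nbhs_left_lt.
  have sM : s * M < 1 by rewrite -ltr_pdivlMr // mul1r.
  have adm : admissible (s * t).
    move=> j; have := i0M j isT; rewrite /flow_eigen /= => jM.
    rewrite (_ : 2 * (s * t) * p j = s * (2 * t * p j)); last by ring.
    by rewrite subr_gt0 (le_lt_trans _ sM) // ler_wpM2l // ltW.
  have st : (a < (s * t)%:E < b)%E.
    apply: flow_segment => //; rewrite ltW //=.
    by case/andP: s01 => _; apply: le_trans; exact: ltW.
  rewrite /= flow_eq_explicit_admissible // chern_ricci_op_explicit_flow //.
  rewrite diagop_basis // dotZl (dot_basis oe) eqxx mulr1 /flow_eigen.
  rewrite (_ : 2 * (s * t) * p i0 = s * M); last by rewrite /M; ring.
  by rewrite mulrC divfK // gt_eqF // subr_gt0.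
have p0 : p i0 = 0.
  by have := cvg_unique _ (cvg_cst (p i0)) c1; apply.
by move: M0; rewrite /M p0 mulr0 ltxx.
Unshelve. all: by end_near.
Qed.

Lemma flow_eq_explicit (t : R) : (a < t%:E < b)%E -> mu t = explicit_flow t.
Proof. by move=> tab; apply/flow_eq_explicit_admissible/flow_admissible. Qed.

End Solution.
End ExplicitFlow.

(** * Brackets with prescribed structure constants *)

Section BracketCoefficients.
Context {R : realType} {V : vectType R}.
Local Notation N := (\dim {:V}).
Variables (g : {dot V for idfun}) (e : N.-tuple V).
Hypothesis oe : orthonormal g e.
Local Notation E i := (tnth e i).

(** A rank-one map; the codomain W is arbitrary so that nesting two of them gives a bracket with a
    single nonzero structure constant. *)
Definition dyad (W : vectType R) (x : V) (y : W) : 'Hom(V, W) :=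
  linfun (fun X => g X x *: y).

Lemma dyadE (W : vectType R) (x : V) (y : W) X : dyad x y X = g X x *: y.
Proof.
pose f X : W := g X x *: y.
have lin : linear f by move=> c u v; rewrite /f dotDl dotZl scalerDl scalerA.
pose lf := GRing.isLinear.Build _ _ _ _ f lin.
pose F : {linear V -> W} := HB.pack f lf.
by rewrite /dyad -[X in linfun X]/(F : _ -> _) lfunE.
Qed.

Definition coef_bracket (C : 'I_N -> 'I_N -> 'I_N -> R) : bracket V :=
  \sum_i \sum_j \sum_k C i j k *: dyad (E i) (dyad (E j) (E k)).

Lemma coef_bracketE C i j k :
  g (coef_bracket C (E i) (E j)) (E k) = C i j k.
Proof.
have sum_bracketE (F : 'I_N -> bracket V) :
    g ((\sum_l F l) (E i) (E j)) (E k) = \sum_l g (F l (E i) (E j)) (E k).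
  by rewrite sum_lfunE sum_lfunE dot_suml.
have sumE (F : 'I_N -> R) l : (forall l', l' != l -> F l' = 0) -> \sum_l F l = F l.
  by move=> H; rewrite (bigD1 l) //= big1 ?addr0.
rewrite /coef_bracket sum_bracketE (sumE _ i) => [|i' /negbTE ii'].
  rewrite sum_bracketE (sumE _ j) => [|j' /negbTE jj'].
    rewrite sum_bracketE (sumE _ k) => [|k' /negbTE kk'].
      by rewrite !scale_lfunE !dyadE scale_lfunE !dyadE !dotZl !(dot_basis oe) !eqxx !mul1r mulr1.
    by rewrite !scale_lfunE !dyadE scale_lfunE !dyadE !dotZl !(dot_basis oe) kk' !mulr0.
  rewrite sum_bracketE big1 // => k' _.
  by rewrite !scale_lfunE !dyadE scale_lfunE !dyadE !dotZl !(dot_basis oe) [j == j']eq_sym jj' mul0r !mulr0.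
rewrite sum_bracketE big1 // => j' _; rewrite sum_bracketE big1 // => k' _.
by rewrite !scale_lfunE !dyadE scale_lfunE !dotZl !(dot_basis oe) [i == i']eq_sym ii' mul0r mulr0.
Qed.

End BracketCoefficients.

(** * Scaling, normalization and conditions closed under limits *)

Section Rescaling.
Context {R : realType} {V : vectType R}.
Local Notation N := (\dim {:V}).
Variables (w : {skew_symmetric V}) (g : {dot V for idfun}).
Local Notation J := (complex_structure w g).
Local Notation P mu := (chern_ricci_op mu w g).
Hypotheses (ndw : nondegenerate w) (JJ : (J \o J)%VF = - \1%VF).
Implicit Types (mu lam : bracket V).

Lemma scale_bracketE a mu X Y : (a *: mu) X Y = a *: mu X Y.
Proof. by rewrite !scale_lfunE. Qed.

Lemma is_lie_bracketZ a mu : is_lie_bracket mu -> is_lie_bracket (a *: mu).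
Proof.
move=> [sk jac]; split=> [X|X Y Z]; rewrite !scale_bracketE.
  by rewrite sk scaler0.
by rewrite !linearZ /= !scalerA -!scalerDr jac scaler0.
Qed.

Lemma integrableZ a mu : nijenhuis_free w g mu -> nijenhuis_free w g (a *: mu).
Proof.
move=> I X Y; rewrite !scale_bracketE !linearZ /=. rewrite -!scalerDr.
by rewrite I scaler0.
Qed.

Lemma chern_ricci_opZ a mu : P (a *: mu) = a ^+ 2 *: P mu.
Proof.
apply: (chern_ricci_op_unique JJ) => // X Y.
rewrite scale_lfunE dotZl dot_chern_ricci_op // /chern_ricci_form.
rewrite !scale_bracketE !linearZ /= !scale_lfunE !linearZ /= !scalerA.
by rewrite -comp_lfunZr !lfun_trZ; ring.
Qed.

Lemma normalized_bracketZ a mu : 0 < a ->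
  normalized_bracket g (a *: mu) = normalized_bracket g mu.
Proof.
move=> a0; rewrite /normalized_bracket bracket_normZ gtr0_norm // invfM scalerA.
by rewrite mulrAC mulVf ?mul1r // gt_eqF.
Qed.

Lemma bracket_norm_neq0 mu : mu != 0 -> bracket_norm g mu != 0.
Proof. by apply: contra_neq => /bracket_norm_eq0. Qed.

Section Closedness.
Context {T : Type} {F : set_system T} {FF : ProperFilter F}.
Variables (f : T -> bracket V) (lam : bracket V).
Hypothesis f_lam : bracket_cvg g F f lam.

Lemma polyfun_closed phi : polyfun g phi -> (\forall t \near F, phi (f t) = 0) ->
  phi lam = 0.
Proof.
move=> pf nf; have c0 : (fun t => phi (f t)) @ F --> (0 : R).
  by apply: cvg_near_eq nf _; exact: cvg_cst.
exact: (cvg_unique _ (polyfun_cvg _ pf f_lam) c0).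
Qed.

Lemma normalized_bracket_cvg : lam != 0 ->
  bracket_cvg g F (fun t => normalized_bracket g (f t)) (normalized_bracket g lam).
Proof.
move=> lam0; apply/bracket_cvgP => X Y Z.
rewrite scale_bracketE dotZl.
rewrite (_ : (fun _ => _) = (fun t => (bracket_norm g (f t))^-1 * g (f t X Y) Z)).
  apply: cvgM; last exact: (bracket_cvgP g f lam).1.
  apply: cvgV; first exact: bracket_norm_neq0.
  by apply: bracket_norm_cvg; exact/bracket_cvgP.
by apply: boolp.funext => t; rewrite scale_bracketE dotZl.
Qed.

Lemma is_lie_bracket_closed : (\forall t \near F, is_lie_bracket (f t)) ->
  is_lie_bracket lam.
Proof.
move=> L; split=> [X|X Y Z]; apply: (@dot_ext _ _ g) => U; rewrite linear0l.
  apply: (polyfun_closed (polyfun_coef g X X U)).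
  by apply: filterS L => t [-> _]; rewrite linear0l.
rewrite !dotDl.
have pf3 : polyfun g (fun mu => g (mu X (mu Y Z)) U + g (mu Y (mu Z X)) U +
    g (mu Z (mu X Y)) U).
  by apply: polyfunD; first apply: polyfunD; exact: polyfun_comp_r.
apply: (polyfun_closed pf3).
by apply: filterS L => t [_ jac]; rewrite -!dotDl jac linear0l.
Qed.

Lemma integrable_closed : (\forall t \near F, nijenhuis_free w g (f t)) ->
  nijenhuis_free w g lam.
Proof.
move=> L X Y; apply: (@dot_ext _ _ g) => U; rewrite linear0l.
have pf : polyfun g (fun mu => g (mu (J X) (J Y)) U + - g (mu X Y) U +
    - g (J (mu (J X) Y)) U + - g (J (mu X (J Y))) U).
  by repeat (apply: polyfunD || apply: polyfunN || exact: polyfun_coef ||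
    exact: polyfun_lfun).
rewrite !dotDl !dotNl; apply: (polyfun_closed pf).
by apply: filterS L => t I; rewrite -!dotNl -!dotDl I linear0l.
Qed.

End Closedness.
End Rescaling.

(** * The ends of the maximal interval *)

Section MaximalInterval.
Context {R : realType} {V : vectType R}.
Local Notation N := (\dim {:V}).
Variables (w : {skew_symmetric V}) (g : {dot V for idfun}).
Local Notation J := (complex_structure w g).
Local Notation P mu := (chern_ricci_op mu w g).
Hypotheses (ndw : nondegenerate w) (JJ : (J \o J)%VF = - \1%VF).
Variables (mu0 : bracket V) (e : N.-tuple V) (p : 'I_N -> R).
Hypotheses (lie0 : is_lie_bracket mu0) (int0 : nijenhuis_free w g mu0).
Hypotheses (oe : orthonormal g e) (PE : P mu0 = diagop g e p).
Variables (a b : \bar R) (mu : R -> bracket V).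
Hypothesis max_mu : is_maximal_bracket_flow w g mu0 a b mu.

Lemma maximal_flow_admissible (t : R) : (a < t%:E < b)%E -> admissible p t.
Proof.
case: max_mu => ab mu00 flow _.
exact: (flow_admissible ndw JJ lie0 int0 oe PE ab mu00 flow).
Qed.

Lemma maximal_flow_explicit (t : R) : (a < t%:E < b)%E ->
  mu t = explicit_flow g mu0 e p t.
Proof.
case: max_mu => ab mu00 flow _.
exact: (flow_eq_explicit ndw JJ lie0 int0 oe PE ab mu00 flow).
Qed.

Lemma admissible_open (r : R) : admissible p r ->
  exists2 d, 0 < d & forall t, `|r - t| < d -> admissible p t.
Proof.
move=> adm.
have : \forall t \near r, admissible p t.
  suff H i : \forall t \near r, 0 < flow_eigen p t i by exact: (filter_forall _ H).
  have c : flow_eigen p^~ i @ r --> flow_eigen p r i.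
    apply: cvgB; first exact: cvg_cst.
    apply: cvgM; last exact: cvg_cst.
    by apply: cvgM; [exact: cvg_cst | exact: cvg_id].
  exact: (cvgr_gt _ c _ (adm i)).
by move=> /nbhs_ballP[d /= d0 H]; exists d => // t rt; exact: H.
Qed.

(** A negative value at r would force a zero at the interior time s r with s = 1 / (2 r p_i), where
    the flow is admissible. *)
Lemma maximal_flow_end_ge0 (r : R) i : a = r%:E \/ b = r%:E ->
  0 <= flow_eigen p r i.
Proof.
move=> abr; rewrite leNgt; apply/negP => H.
have ab : (a < 0%:E < b)%E by case: max_mu.
pose s := (2 * r * p i)^-1.
have rp : 1 < 2 * r * p i by move: H; rewrite /flow_eigen; lra.
have s0 : 0 < s by rewrite invr_gt0; lra.
have s1 : s < 1 by rewrite invf_lt1; lra.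
have sr : (a < (s * r)%:E < b)%E.
  case: abr ab => ->; rewrite !lte_fin => /andP[r0 b0]; apply/andP; split.
  - by rewrite ?lte_fin; nra.
  - by apply: lt_trans b0; rewrite ?lte_fin; nra.
  - by apply: lt_trans r0 _; rewrite ?lte_fin; nra.
  - by rewrite ?lte_fin; nra.
have sE : s * (2 * r * p i) = 1 by rewrite mulVf // gt_eqF //; lra.
by have := maximal_flow_admissible sr i; rewrite /flow_eigen; nra.
Qed.

(** Otherwise r would be admissible, and so would the times near it; the explicit solution would
    then extend the flow beyond r, against maximality. *)
Lemma maximal_flow_end (r : R) : a = r%:E \/ b = r%:E ->
  exists i, flow_eigen p r i = 0.
Proof.
move=> abr; apply: contrapT => no.
have adm : admissible p r.
  move=> i; rewrite lt_neqAle eq_sym maximal_flow_end_ge0 // andbT.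
  by apply/eqP => H; apply: no; exists i.
have [d d0 Hd] := admissible_open adm.
have extend (a' b' : \bar R) : (a' <= a)%E -> (b <= b')%E ->
    (forall t : R, (a' < t%:E < b')%E -> admissible p t) -> a' = a /\ b' = b.
  move=> aa bb adm'; case: max_mu => _ _ _ H.
  apply: (H _ _ (explicit_flow g mu0 e p)) => // t.
    move=> /adm' at_; split; first by case: (explicit_flow_lie lie0 oe at_).
    exact: (explicit_flow_derive ndw JJ).
  by move=> /maximal_flow_explicit.
case: abr => abr.
  have [||t /andP[at_ tb]|+ _] := extend (r - d)%:E b.
  - by rewrite abr lee_fin; lra.
  - by [].
  - have [tr|rt] := leP t r.
      apply: Hd; move: at_; rewrite lte_fin => at_.
      by rewrite ger0_norm; lra.
    by apply: maximal_flow_admissible; rewrite tb abr lte_fin rt.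
  - by rewrite abr => -[]; lra.
have [||t /andP[at_ tb]|_ +] := extend a (r + d)%:E.
- by [].
- by rewrite abr lee_fin; lra.
- have [tr|rt] := ltP t r.
    by apply: maximal_flow_admissible; rewrite at_ abr lte_fin tr.
  apply: Hd; move: tb; rewrite lte_fin => tb.
  by rewrite ler0_norm; lra.
- by rewrite abr => -[]; lra.
Qed.

End MaximalInterval.

(** * The normalized limit under a common factorization of the entries 1 - 2 t p_i *)

Section Limit.
Context {R : realType} {V : vectType R}.
Local Notation N := (\dim {:V}).
Variables (w : {skew_symmetric V}) (g : {dot V for idfun}).
Local Notation J := (complex_structure w g).
Local Notation P mu := (chern_ricci_op mu w g).
Hypotheses (ndw : nondegenerate w) (JJ : (J \o J)%VF = - \1%VF).
Variables (mu0 : bracket V) (e : N.-tuple V) (p : 'I_N -> R).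
Hypotheses (lie0 : is_lie_bracket mu0) (int0 : nijenhuis_free w g mu0).
Hypotheses (mu0_neq0 : mu0 != 0).
Hypotheses (oe : orthonormal g e) (PE : P mu0 = diagop g e p).
Local Notation E i := (tnth e i).
Context {F : set_system R} {FF : ProperFilter F}.
Variables (kappa s : R -> R) (eps : 'I_N -> bool).
Variables (u : 'I_N -> R -> R) (U : 'I_N -> R).
Hypotheses (U0 : forall i, 0 < U i) (uU : forall i, u i @ F --> U i).
Hypotheses (s_to0 : s @ F --> 0).
Hypothesis factor : \forall t \near F, [/\ 0 < kappa t, 0 < s t &
  forall i, flow_eigen p t i = kappa t * s t ^+ eps i * u i t].

Let c i j k := g (mu0 (E i) (E j)) (E k).
(* Twice the order in s of the coefficient (i, j, k) of the explicit solution,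
   shifted by 2 so that the truncated subtraction is exact. *)
Let ord i j k : nat := (2 + eps k - eps i - eps j)%N.

Lemma ordE i j k : (ord i j k)%:R = 2 + (eps k)%:R - (eps i)%:R - (eps j)%:R :> R.
Proof.
by rewrite /ord !natrB ?natrD //; case: (eps i); case: (eps j); case: (eps k).
Qed.

Lemma exists_min_order : exists m : nat,
  (forall i j k, c i j k != 0 -> (m <= ord i j k)%N) /\
  exists i j k, c i j k != 0 /\ ord i j k = m.
Proof.
have [[[i j] k] c0] : exists x : 'I_N * 'I_N * 'I_N, c x.1.1 x.1.2 x.2 != 0.
  apply: contrapT => no; case/eqP: mu0_neq0; apply: (bracket_basis_ext oe) => i j k.
  rewrite !zero_lfunE linear0l; apply/eqP; apply: contrapT => ijk.
  by apply: no; exists (i, j, k); apply/negP.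
have [[[i1 j1] k1] c1 min1] := @arg_minnP _ (i, j, k)
  (fun x => c x.1.1 x.1.2 x.2 != 0) (fun x => ord x.1.1 x.1.2 x.2) c0.
exists (ord i1 j1 k1); split; last by exists i1, j1, k1.
by move=> i' j' k' c'; exact: (min1 (i', j', k')).
Qed.

Lemma rescaled_limit : exists (m : nat) (lam : bracket V) (scal : R -> R),
  [/\ forall i j k, g (lam (E i) (E j)) (E k) != 0 -> ord i j k = m,
      lam != 0,
      \forall t \near F, 0 < scal t &
      bracket_cvg g F (fun t => scal t *: explicit_flow g mu0 e p t) lam].
Proof.
have [m [m_min [i0 [j0 [k0 [c0 m0]]]]]] := exists_min_order.
pose W i j k := Num.sqrt (U k) / (Num.sqrt (U i) * Num.sqrt (U j)).
pose lam := coef_bracket g e (fun i j k => if ord i j k == m then W i j k * c i j k else 0).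
(* A coefficient of the explicit solution is c_ijk kappa^(-1/2) s^((ord - 2)/2) times a convergent
   ratio of roots of the u's; [scal] cancels the powers of kappa and s for ord = m. *)
pose scal t := Num.sqrt (kappa t) * Num.sqrt (s t) ^+ 2 / Num.sqrt (s t) ^+ m.
have lamE := coef_bracketE oe.
have Us i : 0 < Num.sqrt (U i) by rewrite sqrtr_gt0.
exists m, lam, scal; split.
- by move=> i j k; rewrite lamE; case: (ord i j k =P m) => // _; rewrite eqxx.
- apply/eqP => lam0; have := lamE (fun i j k => if ord i j k == m then W i j k * c i j k else 0) i0 j0 k0.
  rewrite -/lam lam0 !zero_lfunE linear0l m0 eqxx => /esym/eqP.
  by rewrite !mulf_eq0 (negbTE c0) orbF invr_eq0 mulf_eq0 !gt_eqF.
- by apply: filterS factor => t [k1 s1 _]; rewrite !(mulr_gt0, invr_gt0, exprn_gt0, sqrtr_gt0).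
apply: (bracket_cvg_basis oe) => i j k; rewrite lamE.
have [cijk|cijk] := eqVneq (c i j k) 0.
  rewrite cijk mulr0 if_same; apply: cvg_near_eq (cvg_cst 0); apply: nearW => t.
  by rewrite scale_bracketE dotZl explicit_flowE // -/(c i j k) cijk !mulr0.
have mo := m_min _ _ _ cijk.
pose W' t := Num.sqrt (u k t) / (Num.sqrt (u i t) * Num.sqrt (u j t)).
have sqc l : (fun t => Num.sqrt (u l t)) @ F --> Num.sqrt (U l).
  exact: (continuous_cvg _ (@sqrt_continuous R (U l)) (uU (i:=l))).
have cW : W' @ F --> W i j k.
  apply: cvgM; first exact: sqc.
  apply: cvgV; first by rewrite mulf_neq0 ?gt_eqF.
  by apply: cvgM; exact: sqc.
(* The surplus power of s after rescaling: constantly 1 at the minimal order, tending to 0 above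
   it. *)
have c1 : (fun t => Num.sqrt (s t) ^+ (ord i j k - m)) @ F --> ((ord i j k == m)%:R : R).
  have st : (fun t => Num.sqrt (s t)) @ F --> (0 : R).
    rewrite -[X in _ --> X](sqrtr0 R).
    exact: (continuous_cvg _ (@sqrt_continuous R 0)).
  have [->|om] := eqVneq (ord i j k) m.
    by rewrite subnn; exact: cvg_cst.
  have : (0 < ord i j k - m)%N by rewrite subn_gt0 ltn_neqAle eq_sym om.
  case: (ord i j k - m)%N => // n _.
  have := cvg_comp _ _ st (@exprn_continuous R n.+1 0); rewrite expr0n; exact.
have -> : (if ord i j k == m then W i j k * c i j k else 0) =
    (ord i j k == m)%:R * W i j k * c i j k by case: eqP; rewrite ?mul1r ?mul0r.
have up : \forall t \near F, forall l, 0 < u l t.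
  apply: filter_forall => l; exact: (cvgr_gt _ (uU (i:=l)) _ (U0 l)).
apply: cvg_near_eq (cvgM (cvgM c1 cW) (cvg_cst (c i j k))).
near=> t.
have ut l : 0 < u l t by move: l; near: t.
have [kt st fl] : [/\ 0 < kappa t, 0 < s t &
  forall i, flow_eigen p t i = kappa t * s t ^+ eps i * u i t] by near: t.
have hE l : Num.sqrt (flow_eigen p t l) =
    Num.sqrt (kappa t) * Num.sqrt (s t) ^+ eps l * Num.sqrt (u l t).
  rewrite fl !sqrtrM ?mulr_ge0 ?exprn_ge0 ?ltW //.
  by case: (eps l); rewrite ?expr1 ?expr0 ?sqrtr1.
rewrite scale_bracketE dotZl explicit_flowE // !hE -/(c i j k) /scal /W'.
have u0 l : Num.sqrt (u l t) != 0 by rewrite gt_eqF // sqrtr_gt0.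
have q0 : Num.sqrt (kappa t) != 0 by rewrite gt_eqF // sqrtr_gt0.
have s0 n : Num.sqrt (s t) ^+ n != 0 by rewrite expf_neq0 // gt_eqF // sqrtr_gt0.
have sE : Num.sqrt (s t) ^+ (ord i j k - m) = Num.sqrt (s t) ^+ 2 *
    Num.sqrt (s t) ^+ eps k / (Num.sqrt (s t) ^+ m * Num.sqrt (s t) ^+ eps i *
    Num.sqrt (s t) ^+ eps j).
  apply: (canRL (mulfK _)); first by rewrite !mulf_neq0.
  rewrite !mulrA -!exprD subnK //; congr (_ ^+ _); rewrite /ord.
  by case: (eps i); case: (eps j); case: (eps k).
rewrite /= sE; move: (u0 i) (u0 j) (u0 k) (s0 m) (s0 (eps i)) (s0 (eps j)) q0.
move: (_ ^+ m) (_ ^+ eps i) (_ ^+ eps j) (_ ^+ eps k) => B X Y Z.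
move: (Num.sqrt (u i t)) (Num.sqrt (u j t)) (Num.sqrt (u k t)) => x y z.
move: (Num.sqrt (kappa t)) => q x0 y0 z0 B0 X0 Y0 q0.
by field; rewrite ?x0 ?y0 ?z0 ?B0 ?X0 ?Y0 ?q0.
Unshelve. all: by end_near.
Qed.

Hypothesis eps_p : forall i j, p i = p j -> eps i = eps j.
Variables (f : R -> R) (al : 'I_N -> R) (al0 al1 : R).
Hypothesis rate : forall i, (fun t => f t * (p i / flow_eigen p t i)) @ F --> al i.
Hypothesis alE : forall i, al i = al0 + al1 * (eps i)%:R.
Hypothesis al_neq0 : (forall i, p i = 0) \/ exists j, al j != 0.

Lemma factor_admissible : \forall t \near F, admissible p t.
Proof.
have up : \forall t \near F, forall l, 0 < u l t.
  apply: filter_forall => l; exact: (cvgr_gt _ (uU (i:=l)) _ (U0 l)).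
near=> t.
have ut l : 0 < u l t by move: l; near: t.
have [kt st fl] : [/\ 0 < kappa t, 0 < s t &
  forall i, flow_eigen p t i = kappa t * s t ^+ eps i * u i t] by near: t.
by move=> i; rewrite fl !mulr_gt0 // exprn_gt0.
Unshelve. all: by end_near.
Qed.

(* Since P_t is diagonal with entries p_i / (1 - 2 t p_i), the common factor by
   which the brackets are rescaled drops out of the ratios of the entries of
   P_lam, so these are proportional to the limits al_i. *)
Lemma chern_ricci_op_limit (k : R -> R) (lam : bracket V) :
  bracket_cvg g F (fun t => k t *: explicit_flow g mu0 e p t) lam ->
  exists c0 c1, P lam = diagop g e (fun i => c0 + c1 * (eps i)%:R).
Proof.
move=> cl.
have PtE : \forall t \near F, P (k t *: explicit_flow g mu0 e p t) =
    diagop g e (fun i => k t ^+ 2 * (p i / flow_eigen p t i)).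
  apply: filterS factor_admissible => t adm.
  rewrite chern_ricci_opZ // (chern_ricci_op_explicit_flow ndw JJ lie0 int0 oe PE adm).
  apply: (diagopP oe) => i; rewrite scale_lfunE diagop_basis // scalerA.
  by [].
pose L i := g (P lam (E i)) (E i).
have PL : P lam = diagop g e L.
  apply: (diagopP oe) => i; apply: (orthonormal_ext oe) => j.
  rewrite dotZl (dot_basis oe); case: eqVneq => [<-|ij]; first by rewrite mulr1.
  rewrite mulr0; apply: (polyfun_closed cl (polyfun_chern_ricci_op ndw JJ (E i) (E j))).
  apply: filterS PtE => t ->.
  by rewrite diagop_basis // dotZl (dot_basis oe) (negbTE ij) mulr0.
have cL i : (fun t => k t ^+ 2 * (p i / flow_eigen p t i)) @ F --> L i.
  have cP : (fun t => g (P (k t *: explicit_flow g mu0 e p t) (E i)) (E i)) @ F --> L i.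
    exact: (polyfun_cvg _ (polyfun_chern_ricci_op ndw JJ (E i) (E i)) cl).
  apply: cvg_near_eq cP; apply: filterS PtE => t ->.
  by rewrite diagop_basis // dotZl (dot_basis oe) eqxx mulr1.
(* Before the limit both sides are the same product, so the growth rates of k and f need not be
   compared. *)
have Lal i j : L i * al j = L j * al i.
  pose G l n t := (k t ^+ 2 * (p l / flow_eigen p t l)) *
    (f t * (p n / flow_eigen p t n)).
  have cG l n : G l n @ F --> L l * al n by exact: cvgM (cL l) (rate (i:=n)).
  suff GE : G i j = G j i by have := cG i j; rewrite GE => /(cvg_unique _)/(_ (cG j i)); apply.
  by apply: boolp.funext => t; rewrite /G; ring.
(* If P = 0 then P_lam = 0; otherwise a nonzero al_j fixes the proportionality constant L_j /
   al_j. *)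
case: al_neq0 => [p0|[j aj]].
  exists 0, 0; rewrite PL; congr diagop; apply: boolp.funext => i.
  rewrite mul0r addr0; have := cL i.
  rewrite (_ : (fun _ => _) = cst 0) => [c0|]; last first.
    by apply: boolp.funext => t; rewrite p0 mul0r mulr0.
  exact: (cvg_unique _ c0 (cvg_cst 0)).
exists (L j / al j * al0), (L j / al j * al1).
rewrite PL; congr diagop; apply: boolp.funext => i.
by rewrite -[_ * al1 * _]mulrA -mulrDr -alE mulrAC -Lal mulfK.
Qed.

Lemma adjoint_diagop a : adjoint g (diagop g e a) = diagop g e a.
Proof.
by apply/lfunP => X; apply: (@dot_ext _ _ g) => Y; rewrite -adjointP diagop_sym.
Qed.

(* A nonzero coefficient (i, j, k) of lam has the minimal order m, that is
   eps_k - eps_i - eps_j = m - 2, so the diagonal operator with entries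
   eps_i + (m - 2) is a derivation of lam. *)
Lemma normalized_limit_soliton (nu : R -> bracket V) :
  (\forall t \near F, nu t = explicit_flow g mu0 e p t) ->
  exists lam, [/\ bracket_cvg g F (fun t => normalized_bracket g (nu t)) lam,
    is_lie_bracket lam, lam != 0 & is_chern_ricci_soliton lam w g].
Proof.
move=> nuE; have [m [Lam [scal [Lam_ord Lam0 scal0 cLam]]]] := rescaled_limit.
pose lam := normalized_bracket g Lam.
pose k t := (bracket_norm g (explicit_flow g mu0 e p t))^-1.
have nL : bracket_norm g Lam != 0 by exact: bracket_norm_neq0.
have lam0 : lam != 0 by rewrite scaler_eq0 invr_eq0 negb_or nL.
have cl : bracket_cvg g F (fun t => k t *: explicit_flow g mu0 e p t) lam.
  apply: (@bracket_cvg_near_eq _ _ g _ _ _ _ _ _ _ (normalized_bracket_cvg cLam Lam0)).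
  apply: filterS scal0 => t st.
  by rewrite normalized_bracketZ.
have lam_lie : is_lie_bracket lam.
  apply: (is_lie_bracket_closed cl); apply: filterS factor_admissible => t adm.
  exact/is_lie_bracketZ/(explicit_flow_lie lie0 oe adm).
have lam_int : nijenhuis_free w g lam.
  apply: (integrable_closed cl); apply: filterS factor_admissible => t adm.
  by apply: integrableZ; exact: (explicit_flow_integrable ndw JJ lie0 int0 oe PE).
exists lam; split=> //.
  apply: bracket_cvg_near_eq cl; apply: filterS nuE => t ->; by [].
have [c0 [c1 PE']] := chern_ricci_op_limit cl.
split; first by split.
pose de : R := m%:R - 2.
pose D := diagop g e (fun i => c1 * ((eps i)%:R + de)).
(* D is symmetric, so the right-hand side has entries c0 + c1 eps_i: the shift by [de] that makes D
   a derivation is absorbed in the constant. *)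
exists (c0 - c1 * de), D; split.
- move=> X Y; suff d0 : delta lam D = 0.
    have := deltaE lam D X Y; rewrite d0 !zero_lfunE => /esym/eqP.
    by rewrite subr_eq0 => /eqP.
  apply: (bracket_basis_ext oe) => i j l; rewrite !zero_lfunE linear0l deltaE.
  rewrite !dotDl dotNl !diagop_basis // dot_diagop // !linearZ /= scale_lfunE !dotZl.
  have [->|lijl] := eqVneq (g (lam (E i) (E j)) (E l)) 0; first by rewrite !mulr0; ring.
  have : ord i j l = m.
    apply: Lam_ord; apply: contra_neq lijl => z.
    by rewrite scale_bracketE dotZl z mulr0.
  move=> /(congr1 (fun n : nat => n%:R : R)); rewrite ordE /de => <-; rewrite /GRing.scale /=.
  by ring.
- apply/lfunP => X; rewrite !comp_lfunE.
  by apply: (diagop_complexC ndw JJ lie0 int0 oe PE) => i j /eps_p ->.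
- rewrite adjoint_diagop PE'; apply/esym/(diagopP oe) => i.
  rewrite !(add_lfunE, scale_lfunE) id_lfunE diagop_basis // -scalerDl scalerA -scalerDl.
  by congr (_ *: _); field.
Qed.

End Limit.

(** * Finite and infinite ends of the maximal interval *)

Section EndLimits.
Context {R : realType} {V : vectType R}.
Local Notation N := (\dim {:V}).
Variables (w : {skew_symmetric V}) (g : {dot V for idfun}).
Local Notation J := (complex_structure w g).
Local Notation P mu := (chern_ricci_op mu w g).
Hypotheses (ndw : nondegenerate w) (JJ : (J \o J)%VF = - \1%VF).
Variables (mu0 : bracket V) (e : N.-tuple V) (p : 'I_N -> R).
Hypotheses (lie0 : is_lie_bracket mu0) (int0 : nijenhuis_free w g mu0).
Hypotheses (mu0_neq0 : mu0 != 0).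
Hypotheses (oe : orthonormal g e) (PE : P mu0 = diagop g e p).
Variables (a b : \bar R) (mu : R -> bracket V).
Hypothesis max_mu : is_maximal_bracket_flow w g mu0 a b mu.
Context {F : set_system R} {FF : ProperFilter F}.
Hypothesis F_ab : \forall t \near F, (a < t%:E < b)%E.
(* sg = 1 at the right end of the interval and sg = -1 at its left end. *)
Variable sg : R.
Hypothesis sg_sqr : sg * sg = 1.

Definition has_soliton_limit := exists lam : bracket V,
  [/\ bracket_cvg g F (fun t => normalized_bracket g (mu t)) lam,
    is_lie_bracket lam, lam != 0 & is_chern_ricci_soliton lam w g].

Lemma sg_neq0 : sg != 0.
Proof. by apply: contra_eq_neq sg_sqr => ->; rewrite mul0r eq_sym oner_eq0. Qed.

Lemma sg_half : sg / 2 = (2 * sg)^-1.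
Proof. by rewrite invfM (mulr1_eq sg_sqr) mulrC. Qed.

Lemma sg_half_neq0 : sg / 2 != 0.
Proof. by rewrite mulf_neq0 ?sg_neq0 // invr_eq0 pnatr_eq0. Qed.

Lemma maximal_flow_near : \forall t \near F, mu t = explicit_flow g mu0 e p t.
Proof.
apply: filterS F_ab => t.
exact: (maximal_flow_explicit ndw JJ lie0 int0 oe PE max_mu).
Qed.

(** The factorization has kappa = 1 and s = sg (r - t), the distance to the end; eps marks the
    entries that vanish at r. *)
Lemma finite_end_soliton (r : R) : 0 < sg * r -> a = r%:E \/ b = r%:E ->
  id @ F --> r -> (\forall t \near F, 0 < sg * (r - t)) -> has_soliton_limit.
Proof.
move=> sr abr Fr Fs.
have ge0 i := maximal_flow_end_ge0 ndw JJ lie0 int0 oe PE max_mu i abr.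
have [j ej] := maximal_flow_end ndw JJ lie0 int0 oe PE max_mu abr.
pose eps i := flow_eigen p r i == 0.
(* If 1 - 2 r p_i = 0, then 1 - 2 t p_i = 2 p_i (r - t), which is s times 2 sg p_i since sg^2 =
   1. *)
pose u i t := if eps i then 2 * (sg * p i) else flow_eigen p t i.
pose U i := if eps i then 2 * (sg * p i) else flow_eigen p r i.
have eps1 i : eps i -> 2 * r * p i = 1 by move=> /eqP; rewrite /flow_eigen; lra.
have r0 : r != 0 by apply: contraTneq sr => ->; rewrite mulr0 ltxx.
have sgp i : eps i -> 0 < 2 * (sg * p i).
  move=> /eps1 e1; have : 2 * (sg * p i) * r ^+ 2 = sg * r.
    by rewrite -[RHS]mulr1 -[X in _ = _ * X]e1; ring.
  move=> E; rewrite -(pmulr_lgt0 _ (_ : 0 < r ^+ 2)) ?E //.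
  by rewrite exprn_even_gt0 //= r0.
have flow_eigen_cvg i : (fun t => flow_eigen p t i) @ F --> flow_eigen p r i.
  apply: cvgB; first exact: cvg_cst.
  apply: cvgM; last exact: cvg_cst.
  by apply: cvgM; [exact: cvg_cst | exact: Fr].
have scvg : (fun t => sg * (r - t)) @ F --> (0 : R).
  suff : (fun t => sg * (r - t)) @ F --> sg * (r - r) by rewrite subrr mulr0.
  apply: cvgM; first exact: cvg_cst.
  by apply: cvgB; [exact: cvg_cst | exact: Fr].
have U0 i : 0 < U i.
  rewrite /U; case: ifPn => [/sgp //|]; rewrite /eps => n0.
  by rewrite lt_neqAle eq_sym n0 ge0.
have uU i : u i @ F --> U i.
  by rewrite /u /U; case: (eps i) => //; exact: cvg_cst.
have fact : \forall t \near F, [/\ 0 < (1 : R), 0 < sg * (r - t) &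
    forall i, flow_eigen p t i = 1 * (sg * (r - t)) ^+ eps i * u i t].
  apply: filterS Fs => t st; split=> // i; rewrite mul1r /u.
  case: ifPn => [/eps1 e1|_]; last by rewrite expr0 mul1r.
  rewrite expr1 /flow_eigen -[X in X - _]e1.
  transitivity ((sg * sg) * (2 * p i * (r - t))); last by ring.
  by rewrite sg_sqr; ring.
(* With f = s, a vanishing entry contributes s p_i / (2 sg p_i s) = sg / 2; every other one tends to
   0. *)
pose al i : R := 0 + sg / 2 * (eps i)%:R.
have eps_p i i' : p i = p i' -> eps i = eps i' by rewrite /eps /flow_eigen => ->.
have rate i : (fun t => sg * (r - t) * (p i / flow_eigen p t i)) @ F --> al i.
  rewrite /al; case epi: (eps i).
    rewrite mulr1 add0r; apply: cvg_near_eq (cvg_cst (sg / 2)).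
    apply: filterS fact => t [_ st fl]; rewrite fl epi /u epi expr1 mul1r.
    have p0 : p i != 0.
      by apply: contraTneq (sgp i epi) => ->; rewrite !mulr0 ltxx.
    have rt : r - t != 0 by apply: contraTneq st => ->; rewrite mulr0 ltxx.
    by rewrite sg_half; field; rewrite ?sg_neq0 ?p0 ?rt.
  rewrite mulr0 addr0 -[X in _ --> X](mul0r (p i / flow_eigen p r i)).
  apply: cvgM => //; apply: cvgM; first exact: cvg_cst.
  by apply: cvgV => //; move: epi; rewrite /eps => ->.
have al_neq0 : (forall i, p i = 0) \/ exists j, al j != 0.
  by right; exists j; rewrite /al /eps ej eqxx mulr1 add0r sg_half_neq0.
exact: (normalized_limit_soliton ndw JJ lie0 int0 mu0_neq0 oe PE (kappa := fun=> 1)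
  U0 uU scvg fact eps_p rate (fun=> erefl) al_neq0 maximal_flow_near).
Qed.

(** Here kappa = sg t and s = 1 / (sg t): entries with p_i = 0 stay equal to 1 = kappa s, the others
    grow like kappa. So eps marks the kernel of P. *)
Lemma infinite_end_soliton : (fun t => (sg * t)^-1) @ F --> (0 : R) ->
  (\forall t \near F, 0 < sg * t) -> (forall t, 0 < sg * t -> (a < t%:E < b)%E) ->
  has_soliton_limit.
Proof.
move=> F0 Fs Hab.
(* If sg p_i were positive, 1 - 2 t p_i would vanish at t = 1 / (2 p_i), a time inside the
   interval. *)
have sgp i : p i != 0 -> 0 < - (2 * (sg * p i)).
  move=> p0; rewrite ltNge; apply/negP => H.
  have H' : 0 < sg * p i.
    rewrite lt_neqAle; apply/andP; split; last by lra.
    by rewrite eq_sym mulf_neq0 ?sg_neq0.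
  pose t := (2 * p i)^-1.
  have tp : 2 * t * p i = 1 by rewrite /t; field.
  have st : 0 < sg * t.
    have E : sg * t * (2 * p i ^+ 2) = sg * p i by rewrite /t; field.
    by rewrite -(pmulr_lgt0 _ (_ : 0 < 2 * p i ^+ 2)) ?E // mulr_gt0 // exprn_even_gt0.
  have := maximal_flow_admissible ndw JJ lie0 int0 oe PE max_mu (Hab t st) i.
  by rewrite /flow_eigen tp subrr ltxx.
pose eps i := p i == 0.
pose u i t := if eps i then 1 else (sg * t)^-1 - 2 * (sg * p i).
pose U i := if eps i then 1 else - (2 * (sg * p i)).
have U0 i : 0 < U i by rewrite /U; case: ifPn => // /sgp.
have uU i : u i @ F --> U i.
  rewrite /u /U; case: (eps i); first exact: cvg_cst.
  rewrite -[X in _ --> X]add0r; apply: cvgB => //; exact: cvg_cst.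
have fact : \forall t \near F, [/\ 0 < sg * t, 0 < (sg * t)^-1 &
    forall i, flow_eigen p t i = sg * t * (sg * t)^-1 ^+ eps i * u i t].
  apply: filterS Fs => t st; split=> //; first by rewrite invr_gt0.
  move=> i; rewrite /u /flow_eigen; case: ifPn => [/eqP ->|_].
    by rewrite expr1 mulfV ?gt_eqF // mulr0 subr0 mulr1.
  rewrite expr0 mulr1 mulrBr mulfV ?gt_eqF //; congr (_ - _).
  transitivity ((sg * sg) * (2 * t * p i)); last by ring.
  by rewrite sg_sqr mul1r.
(* With f = sg t, the limit is - 1 / (2 sg) = - sg / 2 for nonzero p_i, and 0 on the kernel. *)
pose al i : R := - (sg / 2) + sg / 2 * (eps i)%:R.
have eps_p i i' : p i = p i' -> eps i = eps i' by rewrite /eps => ->.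
have rate i : (fun t => sg * t * (p i / flow_eigen p t i)) @ F --> al i.
  rewrite /al; case epi: (eps i).
    rewrite mulr1 addNr; apply: cvg_near_eq (cvg_cst 0); apply: nearW => t.
    by move/eqP: epi => ->; rewrite mul0r mulr0.
  rewrite mulr0 addr0.
  have c1 : (fun t => p i * (u i t)^-1) @ F --> p i * (U i)^-1.
    apply: cvgM; first exact: cvg_cst.
    by apply: cvgV; rewrite ?gt_eqF.
  rewrite (_ : - (sg / 2) = p i * (U i)^-1); last first.
    rewrite /U epi sg_half; field.
    by rewrite sg_neq0 (negbT epi).
  apply: cvg_near_eq c1; apply: filterS fact => t [st _ fl].
  by rewrite fl epi expr0 mulr1 invfM mulrCA mulVKf ?gt_eqF.
have al_neq0 : (forall i, p i = 0) \/ exists j, al j != 0.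
  have [p0|/existsNP[i /eqP pi]] := pselect (forall i, p i = 0); first by left.
  by right; exists i; rewrite /al /eps (negbTE pi) mulr0 addr0 oppr_eq0 sg_half_neq0.
exact: (normalized_limit_soliton ndw JJ lie0 int0 mu0_neq0 oe PE
  U0 uU F0 fact eps_p rate (fun=> erefl) al_neq0 maximal_flow_near).
Qed.

End EndLimits.

Theorem mainTheorem11 (R : realType) (n : nat) (V : vectType R)
    (dimV : \dim {:V} = n.*2)
    (w0 : {skew_symmetric V}) (g0 : {dot V for idfun})
    (mu0 : bracket V) (mu0_lie : is_lie_bracket mu0) (mu0_neq0 : mu0 != 0)
    (mu0_herm : is_hermitian mu0 w0 g0)
    (Tm Tp : \bar R) (mu : R -> bracket V)
    (mu_flow : is_maximal_bracket_flow w0 g0 mu0 Tm Tp mu) :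
  (exists lam : bracket V,
    [/\ bracket_cvg g0 (to_right_end Tp)
          (fun t => normalized_bracket g0 (mu t)) lam,
        is_lie_bracket lam, lam != 0 & is_chern_ricci_soliton lam w0 g0]) /\
  (exists lam : bracket V,
    [/\ bracket_cvg g0 (to_left_end Tm)
          (fun t => normalized_bracket g0 (mu t)) lam,
        is_lie_bracket lam, lam != 0 & is_chern_ricci_soliton lam w0 g0]).
Proof.
case: (mu0_herm) => ndw JJ int0.
have symP := chern_ricci_op_sym JJ ndw mu0_lie int0.
have [e [p [oe Pe]]] := orthonormal_eigenbasis symP.
have PE := diagopP oe Pe.
have [a0 b0] : (Tm < 0)%E /\ (0 < Tp)%E by case: mu_flow => /andP[].
split.
- case: Tp b0 mu_flow => [r||] // b0 mu_flow; rewrite /to_right_end.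
    rewrite lte_fin in b0.
    have near_r : \forall t \near r^'-, 0 < t < r.
      by near=> t; apply/andP; split; near: t; [exact: nbhs_left_gt | exact: nbhs_left_lt].
    apply: (finite_end_soliton ndw JJ mu0_lie int0 mu0_neq0 oe PE mu_flow _ (mulr1 1)
      (r := r)).
    + apply: filterS near_r => t /andP[t0 tr].
      by rewrite (lt_trans a0) ?lte_fin.
    + by rewrite mul1r.
    + by right.
    + by apply: cvg_at_left_filter; exact: cvg_id.
    + by apply: filterS near_r => t /andP[t0 tr]; rewrite mul1r subr_gt0.
  have near_y : \forall t \near +oo, (0 : R) < t by exact: nbhs_pinfty_gt.
  apply: (infinite_end_soliton ndw JJ mu0_lie int0 mu0_neq0 oe PE mu_flow _ (mulr1 1)).
  + by apply: filterS near_y => t t0; rewrite (lt_trans a0) ?lte_fin ?ltry.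
  + have V0 : (fun t : R => t^-1) @ pinfty_nbhs R --> (0 : R).
      by apply/(gtr0_cvgV0 (f := id) near_y); exact: cvg_id.
    by apply: cvg_near_eq V0; apply: nearW => t; rewrite mul1r.
  + by apply: filterS near_y => t t0; rewrite mul1r.
  + by move=> t; rewrite mul1r => t0; rewrite (lt_trans a0) ?lte_fin ?ltry.
(* The left end is the same argument with sg = -1, so that sg (r - t) and sg t are positive near
   it. *)
- have sqN1 : -1 * -1 = 1 :> R by rewrite mulrNN mulr1.
  case: Tm a0 mu_flow => [r||] // a0 mu_flow; rewrite /to_left_end.
    rewrite lte_fin in a0.
    have near_r : \forall t \near r^'+, r < t < 0.
      by near=> t; apply/andP; split; near: t; [exact: nbhs_right_gt | exact: nbhs_right_lt].
    apply: (finite_end_soliton ndw JJ mu0_lie int0 mu0_neq0 oe PE mu_flow _ sqN1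
      (r := r)).
    + apply: filterS near_r => t /andP[rt t0].
      by rewrite lte_fin rt (lt_trans _ b0) ?lte_fin.
    + by rewrite mulN1r oppr_gt0.
    + by left.
    + by apply: cvg_at_right_filter; exact: cvg_id.
    + by apply: filterS near_r => t /andP[rt t0]; rewrite mulN1r opprB subr_gt0.
  have near_y : \forall t \near -oo, t < (0 : R) by exact: nbhs_ninfty_lt.
  apply: (infinite_end_soliton ndw JJ mu0_lie int0 mu0_neq0 oe PE mu_flow _ sqN1).
  + by apply: filterS near_y => t t0; rewrite ltNyr (lt_trans _ b0) ?lte_fin.
  + have near_Ny : \forall t \near ninfty_nbhs R, 0 < - t.
      by apply: filterS near_y => t t0; rewrite oppr_gt0.
    have Ny : -%R @ ninfty_nbhs R --> +oo.
      apply/cvgNy_compNP; rewrite (_ : _ \o _ = id); first exact: cvg_id.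
      by apply: boolp.funext => t; exact: opprK.
    have V0 : (fun t : R => (- t)^-1) @ ninfty_nbhs R --> (0 : R).
      by apply/(gtr0_cvgV0 near_Ny).
    by apply: cvg_near_eq V0; apply: nearW => t; rewrite mulN1r.
  + by apply: filterS near_y => t t0; rewrite mulN1r oppr_gt0.
  + by move=> t; rewrite mulN1r oppr_gt0 => t0; rewrite ltNyr (lt_trans _ b0) ?lte_fin.
Unshelve. all: by end_near.
Qed.
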